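(* Let $K$ be an arbitrary field and let $I\subset R:=K[x_1,\ldots,x_n]$ be an ideal generated by monomials of degree two, with graded Betti numbers $\beta_{i,j}$. Assume that $I$ does not have a linear resolution, and let $r$ be the smallest integer ($\geq 4$) such that $\beta_{i,r}\neq 0$ for some $i\leq r-3$. If $r=4$, assume moreover that $I$ is squarefree. Then $r$ is the smallest integer $\geq 4$ such that $G(I)^c$ has an induced $r$-cycle, and $$\beta_{r-3,r}=\#\{\text{induced } r\text{-cycles in } G(I)^c\}.$$
   Context: $\beta_{i,j}$ is the number of generators of degree $j$ in the $i$-th step of the minimal graded free resolution of $I$ (not of $R/I$), so $\beta_{0,j}$ counts minimal generators of $I$ of degree $j$. $I$ has a linear resolution if $\beta_{i,j}=0$ whenever $j\neq i+2$. $G(I)$ is the graph with vertex set $\{(1),\ldots,(n)\}$ and edges $(i,j)$, $1\le i\le j\le n$, with $x_ix_j\in I$ (loops $(i,i)$ correspond to $x_i^2\in I$). $G(I)^c$ is the simple graph on the same vertices whose edges are the $(i,j)$, $i<j$, that are not edges of $G(I)$. For $t\ge3$, a $t$-cycle is a subgraph with edges $(v_1,v_2),(v_2,v_3),\ldots,(v_t,v_1)$, $v_1,\ldots,v_t$ distinct; it is induced if no edge of the graph other than those of the cycle joins two of the $v_i$. Cycles are counted as subgraphs. *)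

(* Defs.v *)
From HB Require Import structures.
From mathcomp Require Import all_boot all_order all_algebra.
From mathcomp Require Export mpoly.

Set Implicit Arguments.
Unset Strict Implicit.
Unset Printing Implicit Defensive.

Import GRing.Theory.
Local Open Scope ring_scope.

Definition is_smallest (P : nat -> Prop) (r : nat) : Prop :=
  P r /\ forall s, P s -> (r <= s)%N.

Section Ideals.
Variables (K : fieldType) (n : nat).
Implicit Types (I : {pred {mpoly K[n]}}) (M : 'X_{1..n} -> Prop).

Definition ideal_gen (S : {mpoly K[n]} -> Prop) (p : {mpoly K[n]}) : Prop :=
  exists s : seq ({mpoly K[n]} * {mpoly K[n]}),
    (forall cg, cg \in s -> S cg.2) /\ p = \sum_(cg <- s) cg.1 * cg.2.

Definition generated_by_monomials I M : Prop :=
  forall p, p \in I <-> ideal_gen (fun q => exists2 m, M m & q = 'X_[m]) p.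

Definition generated_by_quadratic_monomials I : Prop :=
  exists2 M, (forall m, M m -> mdeg m = 2%N) & generated_by_monomials I M.

Definition squarefree_monomial_ideal I : Prop :=
  exists2 M, (forall m, M m -> forall i, (m i <= 1)%N)
           & generated_by_monomials I M.

End Ideals.

Section Resolutions.
Variables (K : fieldType) (n : nat).
Implicit Types (I : {pred {mpoly K[n]}}).

(* A sequence of maps ... -> F_1 -> F_0 -> R of finitely generated graded free
   modules, R = K[x_1, ..., x_n], in which F_i is the direct sum of the R(-d),
   d = res_deg i k for k < res_rank i.  Elements of F_i are row vectors and
   maps act by right multiplication: res_diff i is the matrix of
   F_(i+1) -> F_i, and res_aug that of F_0 -> R.  Natural numbers suffice as
   degrees, since a submodule of R lives in nonnegative degrees. *)
Record free_sequence := FreeSequence {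
  res_rank : nat -> nat;
  res_deg : forall i, 'I_(res_rank i) -> nat;
  res_aug : 'cV[{mpoly K[n]}]_(res_rank 0);
  res_diff : forall i, 'M[{mpoly K[n]}]_(res_rank i.+1, res_rank i)
}.

Implicit Type F : free_sequence.

(* p is homogeneous of degree d - e in Z; in particular p = 0 when d < e. *)
Definition homog_diff (d e : nat) (p : {mpoly K[n]}) : Prop :=
  forall m, m \in msupp p -> (mdeg m + e)%N = d.

Definition graded F : Prop :=
  (forall k, homog_diff (res_deg k) 0 (res_aug F k 0)) /\
  (forall i k l, homog_diff (res_deg k) (res_deg l) (res_diff F i k l)).

Definition resolves I F : Prop :=
  [/\ forall p, p \in I <-> exists v : 'rV_(res_rank F 0),
        (v *m res_aug F) 0 0 = p,
      forall v : 'rV_(res_rank F 0),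
        v *m res_aug F = 0 <-> exists w, v = w *m res_diff F 0
    & forall i (v : 'rV_(res_rank F i.+1)),
        v *m res_diff F i = 0 <-> exists w, v = w *m res_diff F i.+1].

(* Every differential maps F_(i+1) into (x_1, ..., x_n) F_i. *)
Definition minimal F : Prop := forall i k l, (res_diff F i k l)@_0%MM = 0.

Definition minimal_graded_free_resolution I F : Prop :=
  [/\ graded F, resolves I F & minimal F].

Definition betti F (i j : nat) : nat := #|[set k | @res_deg F i k == j]|.

Definition linear_resolution F : Prop :=
  forall i j : nat, j <> (i + 2)%N -> betti F i j = 0%N.

End Resolutions.

Section Graphs.

Definition ideal_graph (K : fieldType) n (I : {pred {mpoly K[n]}}) : rel 'I_n :=
  fun i j => 'X_i * 'X_j \in I.

Definition compl_graph (T : eqType) (e : rel T) : rel T :=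
  fun i j => (i != j) && ~~ e i j.

Variable T : finType.
Implicit Types (e : rel T) (C : {set {set T}}).

Definition cycle_edges (v : seq T) : {set {set T}} :=
  [set [set x; next v x] | x in v].

(* A cycle, viewed as a subgraph, is represented by its set of edges C, each
   edge being a pair of vertices; its vertex set is then cover C. *)
Definition is_cycle e (t : nat) C : bool :=
  (3 <= t)%N &&
  [exists v : t.-tuple T, [&& uniq v, cycle e v & C == cycle_edges v]].

Definition is_induced e C : bool :=
  [forall x in cover C, forall y in cover C, e x y ==> ([set x; y] \in C)].

Definition induced_cycles e (t : nat) : {set {set {set T}}} :=
  [set C | is_cycle e t C && is_induced e C].

End Graphs.

(* Main.v *)
Require Import Defs.
From HB Require Import structures.
From mathcomp Require Import all_boot all_order all_algebra.
From mathcomp Require Import mpoly.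
From mathcomp Require Import zify.

(** Write R = K[x_1, ..., x_n].  Dimension shifting along the minimal
    resolution F in the Koszul complex identifies beta_(i,j) with the dimension
    of the degree j part of the Koszul homology H_(i+1)(x; R/I), which splits
    into strands indexed by multidegrees a.  If a is the indicator of a vertex
    set W, then complementation in W identifies the strand with the reduced
    cochain complex of the clique complex of the subgraph of G(I)^c induced by
    W.  The other strands do not contribute to the relevant beta_(i,j) as soon
    as beta_(1,4) = 0 or I is squarefree.

    If W contains no induced cycle of length at least 4, its clique complex has
    no cohomology in positive degrees: remove a vertex v and induct, the only
    delicate point being degree one, where a shortest path outside v between
    two components of the neighbourhood of v would close up to an induced
    cycle.  Hence for |W| = r a nonzero strand forces W to span an induced
    r-cycle, whose first cohomology is one-dimensional. *)

Set Implicit Arguments.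
Unset Strict Implicit.
Unset Printing Implicit Defensive.

Import GRing.Theory.
Local Open Scope ring_scope.

(** * Graphs without induced cycles *)

(** The minimality of r ties the two directions together. An induced s-cycle with s >= 4 carries a
    nonzero class in the strand of its vertex set, so beta_(s-3,s) is nonzero and r <= s. Hence an
    induced cycle of length at least 4 among r vertices uses all of them.

    The obstacle is a multidegree with an exponent at least 2. If r = 4 there are no loops, and
    coning with a vertex of exponent at least 2 contracts the strand. If r > 4, then beta_(1,4) = 0
    excludes two configurations, each of which would carry a class in H_2 of degree 4: loops b, b'
    adjacent in G(I)^c, in multidegree b^2 b'^2, and a loop b with nonadjacent neighbours u, v in
    G(I)^c, in multidegree b^2 u v. Once these are gone, such a strand is contracted by a cone or
    concentrated on the line j = i + 2.

    Homology is never formed as a quotient: a Betti number is the size of a family that is a basis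
    of cycles modulo boundaries, and dimension shifting carries such families along a linear
    relation. *)

Section AntisymmetricSum.
Variables (V : zmodType) (T : finType).

(* The terms (i, j) and (j, i) are paired: [X = - X] would not suffice in
   characteristic 2. *)
Lemma antisymmetric_sum (A : {set T}) (G : T -> T -> V) :
  (forall i j, i \in A -> j \in A -> i != j -> G i j = - G j i) ->
  \sum_(i in A) \sum_(j in A :\ i) G i j = 0.
Proof.
move=> Ganti; pose lt (i j : T) := (enum_rank i < enum_rank j)%N.
have split_sum i : i \in A -> \sum_(j in A :\ i) G i j =
    \sum_(j in A | lt i j) G i j + \sum_(j in A | lt j i) G i j.
  move=> iA; rewrite (bigID (lt i)) /=; congr (_ + _); apply: eq_bigl => j;
    rewrite !inE /lt.
    case: eqVneq => [->|] /=; first by rewrite ltnn !andbF.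
    by [].
  case: eqVneq => [->|ne_ji] /=; first by rewrite ltnn !andbF.
  case: (j \in A) => //=; rewrite -leqNgt leq_eqVlt.
  by rewrite (inj_eq val_inj) (inj_eq enum_rank_inj) (negbTE ne_ji).
rewrite (eq_bigr _ split_sum) big_split /=.
rewrite [X in _ + X](exchange_big_dep (mem A)) /=; last by move=> i j _ /andP[].
rewrite -big_split big1 //= => i iA.
rewrite [X in _ + X](eq_bigl (fun j => (j \in A) && lt i j)); last first.
  by move=> j /=; rewrite iA.
rewrite -big_split big1 //= => j /andP[jA lt_ij].
rewrite (Ganti i j) ?addNr //.
by apply: contraTneq lt_ij => ->; rewrite /lt ltnn.
Qed.

End AntisymmetricSum.

Section Graph.
Variables (T : finType) (e : rel T).

Definition clique (X : {set T}) :=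
  [forall x in X, forall y in X, (x != y) ==> e x y].

Lemma cliqueP (X : {set T}) :
  reflect (forall x y, x \in X -> y \in X -> x != y -> e x y) (clique X).
Proof.
apply: (iffP forall_inP) => [clX x y xX yX ne_xy | clX x xX].
  by move/forall_inP: (clX x xX) => /(_ y yX); rewrite ne_xy.
by apply/forall_inP => y yX; apply/implyP => ne_xy; apply: clX.
Qed.

Lemma clique_sub (X Y : {set T}) : X \subset Y -> clique Y -> clique X.
Proof.
move=> /subsetP sXY /cliqueP clY; apply/cliqueP => x y xX yX.
by apply: clY; apply: sXY.
Qed.

(* Adjacency of i and j in the cycle 0, 1, ..., m - 1. *)
Definition cadj (m i j : nat) : bool :=
  [|| j == i.+1, i == j.+1, (i == 0) && (j.+1 == m) | (j == 0) && (i.+1 == m)]%N.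

(** A total function on [nat] lets paths be spliced by index arithmetic; its values from [m] on are
    irrelevant. The boolean equality with [cadj] gives the edges and excludes chords at once. *)
Definition icycle (m : nat) (s : nat -> T) : Prop :=
  (forall i j, i < m -> j < m -> s i = s j -> i = j)%N /\
  (forall i j, i < m -> j < m -> e (s i) (s j) = cadj m i j)%N.

Definition chordal (W : {set T}) : Prop :=
  forall m s, (4 <= m)%N -> icycle m s -> ~ (forall i, (i < m)%N -> s i \in W).

Lemma chordal_sub (W W' : {set T}) : W' \subset W -> chordal W -> chordal W'.
Proof.
by move=> /subsetP sW chW m s m4 cs sW'; apply: (chW m s m4 cs) => i /sW'/sW.
Qed.

Hypothesis e_sym : ssrbool.symmetric e.
Hypothesis e_irr : irreflexive e.

Lemma clique1U (v : T) (X : {set T}) :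
  (forall x, x \in X -> e v x) -> clique X -> clique (v |: X).
Proof.
move=> vX /cliqueP clX; apply/cliqueP => x y; rewrite !inE.
case/predU1P => [->|xX] /predU1P[->|yX]; rewrite ?eqxx // => ne_xy.
- exact: vX.
- by rewrite e_sym vX.
- exact: clX.
Qed.

Lemma clique2 (x y : T) : e x y -> clique [set x; y].
Proof.
move=> exy; apply/cliqueP => a b; rewrite !inE.
by case/pred2P=> ->; case/pred2P=> ->; rewrite ?eqxx // e_sym.
Qed.

(* A shortest path outside v between two components of the neighbourhood of v
   would close up, through v, to an induced cycle. *)
Lemma chordal_nbhd_path (U : eqType) (W : {set T}) (v : T) (phi : T -> U) :
  chordal W -> v \in W ->
  (forall x y, x \in W :\ v -> y \in W :\ v -> e v x -> e v y -> e x y ->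
    phi x = phi y) ->
  forall m (s : nat -> T),
    (forall i, (i <= m)%N -> s i \in W :\ v) ->
    (forall i, (i < m)%N -> e (s i) (s i.+1)) ->
    e v (s 0) -> e v (s m) -> phi (s 0) = phi (s m).
Proof.
move=> chW vW phiE; elim/ltn_ind => m IHm s sW se ev0 evm.
case: (posnP m) => [-> //|m_gt0].
have [m1|m_neq1] := eqVneq m 1%N.
  by rewrite m1; apply: phiE; rewrite ?sW // -?m1 // m1 se ?m1.
have m_gt1 : (1 < m)%N by lia.
(* An interior neighbour of [v] cuts the path into two shorter ones of the same kind. *)
have [/existsP[i /andP[/andP[i0 im] evi]]|no_nbr] :=
    boolP [exists i : 'I_m, (0 < i) && (i < m) && e v (s i)]%N.
  rewrite (IHm i _ s) //; first last.
  - by move=> k ki; apply: se; lia.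
  - by move=> k ki; apply: sW; lia.
  have := IHm (m - i)%N _ (fun k => s (k + i)%N) _ _ _ _.
  rewrite add0n (subnK (ltnW im)); apply=> //; first by lia.
  - by move=> k ki; apply: sW; lia.
  - by move=> k ki; rewrite addSn; apply: se; lia.
(* A repeated vertex: the closed detour from [i] to [j] is cut out. *)
have [/existsP[i /existsP[j /andP[lt_ij /eqP sij]]]|s_inj] :=
    boolP [exists i : 'I_m.+1, exists j : 'I_m.+1, (i < j)%N && (s i == s j)].
  pose s' k := if (k <= i)%N then s k else s (k + (j - i))%N.
  have jm := ltn_ord j.
  have := IHm (m - (j - i))%N _ s' _ _ _ _.
  have s'0 : s' 0%N = s 0%N by rewrite /s' leq0n.
  have s'm : s' (m - (j - i))%N = s m.
    rewrite /s'; case: leqP => [le|lt]; last by congr s; lia.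
    have -> : (m - (j - i))%N = i by lia.
    by rewrite sij; congr s; lia.
  rewrite s'0 s'm; apply=> //; first by lia.
  - by move=> k km; rewrite /s'; case: ifP => ki; apply: sW; lia.
  move=> k km; rewrite /s'; case: (leqP k i) => [ki|ki].
    case: (leqP k.+1 i) => [k1i|]; first by apply: se; lia.
    move=> k1i; have -> : k = i by lia.
    rewrite sij; have -> : (i.+1 + (j - i))%N = j.+1 by lia.
    by apply: se; lia.
  by rewrite leqNgt (leq_trans ki) //= addSn; apply: se; lia.
(* A chord: the new path steps from [i] directly to [j], which skips [(j - i).-1] vertices. *)
have [/existsP[i /existsP[j /andP[lt_ij eij]]]|s_ind] :=
    boolP [exists i : 'I_m.+1, exists j : 'I_m.+1,
      (i.+1 < j)%N && e (s i) (s j)].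
  pose s' k := if (k <= i)%N then s k else s (k + (j - i).-1)%N.
  have jm := ltn_ord j.
  have := IHm (m - (j - i).-1)%N _ s' _ _ _ _.
  have s'0 : s' 0%N = s 0%N by rewrite /s' leq0n.
  have s'm : s' (m - (j - i).-1)%N = s m.
    by rewrite /s'; case: leqP => [le|lt]; [lia | congr s; lia].
  rewrite s'0 s'm; apply=> //; first by lia.
  - by move=> k km; rewrite /s'; case: ifP => ki; apply: sW; lia.
  move=> k km; rewrite /s'; case: (leqP k i) => [ki|ki].
    case: (leqP k.+1 i) => [k1i|]; first by apply: se; lia.
    move=> k1i; have -> : k = i by lia.
    by have -> : (i.+1 + (j - i).-1)%N = j by lia.
  by rewrite leqNgt (leq_trans ki) //= addSn; apply: se; lia.
(* The path is now induced and meets the neighbourhood of [v] only at its ends, so prefixing [v]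
   gives an induced cycle of length m + 2 >= 4. *)
pose c k := if k is k'.+1 then s k' else v.
have sv k : (k <= m)%N -> s k != v by move/sW; rewrite !inE => /andP[].
have s_inj' i j : (i < j)%N -> (j <= m)%N -> s i != s j.
  move=> lt_ij jm; apply: contra s_inj => sij.
  have im : (i < m.+1)%N by lia.
  by apply/existsP; exists (Ordinal im); apply/existsP;
     exists (Ordinal (jm : (j < m.+1)%N)); rewrite /= lt_ij.
have s_ind' i j : (i.+1 < j)%N -> (j <= m)%N -> e (s i) (s j) = false.
  move=> lt_ij jm; apply: contraNF s_ind => sij.
  have im : (i < m.+1)%N by lia.
  by apply/existsP; exists (Ordinal im); apply/existsP;
     exists (Ordinal (jm : (j < m.+1)%N)); rewrite /= lt_ij.
have evs i : (i <= m)%N -> e v (s i) = ((i == 0) || (i == m))%N.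
  move=> im; case: eqVneq => [->|i0] //=; case: eqVneq => [->|i_m] //=.
  apply: contraNF no_nbr => evi.
  have im' : (i < m)%N by lia.
  by apply/existsP; exists (Ordinal im'); rewrite /= im' lt0n i0.
have ess i j : (i < j)%N -> (j <= m)%N -> e (s i) (s j) = (j == i.+1).
  move=> lt_ij jm; case: eqVneq => [->|ne]; first by apply: se; lia.
  by apply: s_ind' => //; lia.
exfalso; apply: (chW m.+2 c) => //.
  split.
    move=> [|i] [|j] //=.
    - by move=> _ jm vs; have := sv j; rewrite -vs eqxx; lia.
    - by move=> im _ vs; have := sv i; rewrite vs eqxx; lia.
    move=> im jm sij; case: (ltngtP i j) => [lt|lt|->] //.
    - by have := s_inj' i j lt; rewrite sij eqxx; lia.
    - by have := s_inj' j i lt; rewrite sij eqxx; lia.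
  move=> [|i] [|j] /=.
  - by rewrite e_irr.
  - by move=> _ jm; rewrite evs //; rewrite /cadj; lia.
  - by move=> im _; rewrite e_sym evs //; rewrite /cadj; lia.
  move=> im jm; case: (ltngtP i j) => [lt|lt|->].
  - by rewrite ess //; rewrite /cadj; lia.
  - by rewrite e_sym ess //; rewrite /cadj; lia.
  - by rewrite e_irr /cadj; lia.
by move=> [|i] //= im; have := sW i im; rewrite !inE => /andP[].
Qed.

(** Each component of [W :\ v] meets the neighbourhood of [v] in vertices with a single value of
    [phi], which [h] takes on the whole component; [u0] serves the components that miss the
    neighbourhood. This is the surjectivity on H^0 needed for degree one. *)
Lemma chordal_nbhd_extend (U : eqType) (u0 : U) (W : {set T}) (v : T)
    (phi : T -> U) :
  chordal W -> v \in W ->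
  (forall x y, x \in W :\ v -> y \in W :\ v -> e v x -> e v y -> e x y ->
    phi x = phi y) ->
  exists h : T -> U,
    (forall x, x \in W :\ v -> e v x -> h x = phi x) /\
    (forall x y, x \in W :\ v -> y \in W :\ v -> e x y -> h x = h y).
Proof.
move=> chW vW phiE.
pose e' := [rel x y | [&& e x y, x \in W :\ v & y \in W :\ v]].
have e'_sym : connect_sym e'.
  by apply: sym_connect_sym => x y /=; rewrite e_sym andbCA andbA andbC andbA andbC.
pose nb x u := [&& u \in W :\ v, e v u & connect e' u x].
pose h x := if [pick u | nb x u] is Some u then phi u else u0.
exists h; split; last first.
  move=> x y xW yW exy; rewrite /h; congr (if _ is Some u then _ else _).
  apply: eq_pick => u; rewrite /nb; congr [&& _, _ & _].
  rewrite ![connect e' u _]e'_sym.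
  by apply: same_connect => //; apply: connect1; rewrite /= exy xW.
move=> x xW evx; rewrite /h; case: pickP => [u|]; last first.
  by move/(_ x); rewrite /nb xW evx connect0.
rewrite /nb => /and3P[uW evu /connectP[p p_path x_last]].
pose s i := nth u (u :: p) i.
have s_path i : (i < size p)%N -> e' (s i) (s i.+1).
  by move=> ip; have /pathP := p_path; apply.
have -> : x = s (size p) by rewrite x_last (last_nth u).
have -> : u = s 0%N by [].
apply: (chordal_nbhd_path (W := W) (v := v)) => //; rewrite -?/(s _).
- move=> [|i] ip //=; have := s_path i ip; rewrite /= => /and3P[_ _] //.
- by move=> i /s_path /= /and3P[].
- by rewrite /s -(last_nth u) -x_last.
Qed.

End Graph.

(** * Cochains of clique complexes *)

Section Cochains.
Variables (K : fieldType) (T : finType) (e : rel T).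
Hypothesis e_sym : ssrbool.symmetric e.
Hypothesis e_irr : irreflexive e.

(* Any system of incidence signs that makes [cobd] a differential will do. *)
Variables (sg : T -> {set T} -> K) (W0 : {set T}).
Hypothesis sg2 : forall i X, sg i X * sg i X = 1.
Hypothesis sgA : forall (X : {set T}) i j, X \subset W0 ->
  i \in X -> j \in X -> i != j ->
  sg i X * sg j (X :\ i) = - (sg j X * sg i (X :\ j)).

(** Cochains live on all subsets, and equations are imposed on cliques only; as faces of cliques are
    cliques, other values never interfere. A set of size t is a simplex of dimension t - 1, the
    empty one included. *)
Definition cobd (f : {set T} -> K) (X : {set T}) : K :=
  \sum_(i in X) sg i X * f (X :\ i).

Lemma cobd_cobd f (X : {set T}) : X \subset W0 -> cobd (cobd f) X = 0.
Proof.
move=> XW; rewrite -[RHS](@antisymmetric_sum _ _ X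
  (fun i j => sg i X * sg j (X :\ i) * f (X :\ i :\ j))).
  apply: eq_bigr => i iX; rewrite /cobd mulr_sumr.
  by apply: eq_bigr => j _; rewrite mulrA.
move=> i j iX jX ne_ij; rewrite (sgA XW) // mulNr; congr (- (_ * f _)).
by rewrite !setDDl setUC.
Qed.

Lemma cobdB f g X : cobd (fun Y => f Y - g Y) X = cobd f X - cobd g X.
Proof. by rewrite /cobd -sumrB; apply: eq_bigr => i _; rewrite mulrBr. Qed.

Lemma cobdD f g X : cobd (fun Y => f Y + g Y) X = cobd f X + cobd g X.
Proof. by rewrite /cobd -big_split; apply: eq_bigr => i _; rewrite mulrDr. Qed.

Lemma cobdU f v (X : {set T}) : v \notin X ->
  cobd f (v |: X) =
  sg v (v |: X) * f X + \sum_(i in X) sg i (v |: X) * f (v |: (X :\ i)).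
Proof.
move=> vX; rewrite /cobd (bigD1 v) ?setU11 //= setU1K //; congr (_ + _).
rewrite [LHS](eq_bigl (mem X)); last first.
  move=> i; rewrite !inE; case: eqVneq => [->|] /=; last by rewrite andbT.
  by rewrite (negbTE vX).
apply: eq_bigr => i iX; congr (_ * f _); rewrite setDUl; congr (_ :|: _).
apply/setDidPl; rewrite disjoints1 inE; apply: contraNneq vX => -> //.
Qed.

(** The part of [f] on simplices through [v], read one degree lower on the link of [v]. The sign is
    the one that makes [cobd_link] hold. *)
Definition link_cochain (f : {set T} -> K) v (X : {set T}) :=
  sg v (v |: X) * f (v |: X).

Lemma link_cochainE f v X : f (v |: X) = sg v (v |: X) * link_cochain f v X.
Proof. by rewrite mulrA sg2 mul1r. Qed.

Lemma cobd_link f v (X : {set T}) : v |: X \subset W0 -> v \notin X ->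
  cobd f (v |: X) = sg v (v |: X) * (f X - cobd (link_cochain f v) X).
Proof.
move=> vXW vX; rewrite cobdU // mulrBr; congr (_ + _).
rewrite mulr_sumr -sumrN; apply: eq_bigr => i iX.
rewrite (link_cochainE f v) !mulrA -mulNr; congr (_ * _).
have ne_iv : i != v by apply: contraNneq vX => <-.
have EDi : (v |: X) :\ i = v |: (X :\ i).
  rewrite setDUl; congr (_ :|: _); apply/setDidPl.
  by rewrite disjoints1 inE eq_sym.
have := sgA vXW (setU1r v iX) (setU11 v X) ne_iv.
by rewrite EDi setU1K // => ->; rewrite mulNr.
Qed.

(** Only singletons matter; the sum is a way to read off their element. The sign makes the
    coboundary on an edge a difference of values of [h], up to the orientation [edge_sg]. *)
Definition vcochain (h : T -> K) (X : {set T}) : K :=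
  \sum_(x in X) sg x [set x] * h x.

Definition edge_sg x y := sg x [set x; y] * sg y [set y].

Lemma edge_sg2 x y : edge_sg x y * edge_sg x y = 1.
Proof. by rewrite /edge_sg mulrACA !sg2 mulr1. Qed.

Lemma edge_sgN x y : x \in W0 -> y \in W0 -> x != y ->
  edge_sg y x = - edge_sg x y.
Proof.
move=> xW yW ne_xy; rewrite /edge_sg [[set y; x]]setUC.
have sub : [set x; y] \subset W0 by rewrite subUset !sub1set xW.
have := sgA sub (set21 _ _) (set22 _ _) ne_xy.
rewrite setU1K ?inE // [[set x; y]]setUC setU1K ?inE 1?eq_sym // => ->.
by rewrite opprK.
Qed.

Lemma cobd_edge g x y : x \in W0 -> y \in W0 -> x != y ->
  cobd g [set x; y] =
  edge_sg x y * (sg y [set y] * g [set y] - sg x [set x] * g [set x]).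
Proof.
move=> xW yW ne_xy; rewrite cobdU ?inE // big_set1 setDv setU0 mulrBr; congr (_ + _).
  by rewrite /edge_sg -mulrA [sg y _ * (_ * _)]mulrA sg2 mul1r.
rewrite -mulNr -edge_sgN // /edge_sg -mulrA [sg x _ * (_ * _)]mulrA sg2 mul1r.
by rewrite [[set y; x]]setUC.
Qed.

Lemma vcochain1 h x : vcochain h [set x] = sg x [set x] * h x.
Proof. by rewrite /vcochain big_set1. Qed.

Lemma cobd_vcochain h x y : x \in W0 -> y \in W0 -> x != y ->
  cobd (vcochain h) [set x; y] = edge_sg x y * (h y - h x).
Proof.
by move=> xW yW xy; rewrite cobd_edge // !vcochain1 !mulrA !sg2 !mul1r.
Qed.

(** A Mayer-Vietoris argument for the star of [v] and the complex on [W :\ v], which meet in the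
    link of [v], a clique complex on fewer vertices. The condition [1 < t] means positive
    cohomological degree. *)
Lemma chordal_acyclic (W : {set T}) : W \subset W0 -> chordal e W ->
  forall t f, (1 < t)%N ->
  (forall X : {set T}, X \subset W -> clique e X -> #|X| = t.+1 -> cobd f X = 0) ->
  exists g, forall X : {set T}, X \subset W -> clique e X -> #|X| = t -> f X = cobd g X.
Proof.
have [k] := ubnP #|W|; elim: k W => // k IHk W leWk WW0 chW t f t_gt1 fZ.
have [->|[v vW]] := set_0Vmem W.
  exists f => X; rewrite subset0 => /eqP -> _; rewrite cards0; lia.
have WvW : W :\ v \subset W by apply: subsetDl.
have cardWv : (#|W :\ v| < k)%N by have := cardsD1 v W; rewrite vW; lia.
have [|g0 g0E] := IHk _ cardWv (subset_trans WvW WW0) (chordal_sub WvW chW) t f t_gt1.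
  by move=> X XW; apply: fZ; apply: subset_trans WvW.
(* After this subtraction the cocycle vanishes on cliques avoiding [v], so it amounts to a cocycle
   [f2] on the link. *)
pose f1 X := f X - cobd g0 X.
have f1Z (X : {set T}) : X \subset W -> clique e X -> #|X| = t.+1 -> cobd f1 X = 0.
  move=> XW clX cX; rewrite cobdB fZ // cobd_cobd ?subr0 //.
  exact: subset_trans WW0.
have f10 (X : {set T}) : X \subset W :\ v -> clique e X -> #|X| = t -> f1 X = 0.
  by move=> XW clX cX; rewrite /f1 g0E // subrr.
suff [g1 g1E] : exists g1, forall X : {set T}, X \subset W -> clique e X -> #|X| = t ->
    f1 X = cobd g1 X.
  exists (fun X => g0 X + g1 X) => X XW clX cX.
  by rewrite cobdD -g1E // /f1 addrC subrK.
pose N := [set x in W :\ v | e v x].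
have NWv : N \subset W :\ v by apply/subsetP => x; rewrite inE => /andP[].
have NW := subset_trans NWv WvW.
have vN (X : {set T}) : X \subset N -> v \notin X.
  by move=> XN; apply/negP => /(subsetP XN); rewrite !inE eqxx.
have vXW (X : {set T}) : X \subset N -> v |: X \subset W.
  by move=> XN; rewrite subUset sub1set vW (subset_trans XN).
have clvX (X : {set T}) : X \subset N -> clique e X -> clique e (v |: X).
  move=> XN; apply: clique1U => // x /(subsetP XN).
  by rewrite inE => /andP[].
pose f2 := link_cochain f1 v.
have f2Z (X : {set T}) : X \subset N -> clique e X -> #|X| = t -> cobd f2 X = 0.
  move=> XN clX cX; have := f1Z _ (vXW X XN) (clvX X XN clX).
  rewrite cardsU1 vN // cX => /(_ erefl).
  rewrite cobd_link ?vN //; last exact: subset_trans (vXW X XN) WW0.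
  rewrite f10 //; last exact: subset_trans NWv.
  move/(congr1 (fun z => sg v (v |: X) * z)); rewrite mulrA sg2 mul1r mulr0 sub0r.
  by move/eqP; rewrite oppr_eq0 => /eqP.
have decomp (X : {set T}) : X \subset W -> clique e X -> v \in X -> #|X| = t ->
    [/\ X = v |: (X :\ v), X :\ v \subset N, clique e (X :\ v) & #|X :\ v| = t.-1].
  move=> XW clX vX cX; split; first by rewrite setD1K.
  - apply/subsetP => x; rewrite !inE => /andP[xv xX].
    rewrite xv (subsetP XW) //=; move/cliqueP: clX; apply => //; by rewrite eq_sym.
  - by apply: clique_sub clX; apply: subsetDl.
  - by have := cardsD1 v X; rewrite vX; lia.
(* Here [f2] is a 0-cocycle, which need not bound on the link. It is extended instead to a function
   constant on the components of [W :\ v], whose coboundary vanishes off [v]; the value 0 at [v]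
   gives the right edges through [v]. *)
have [t2|t_neq2] := eqVneq t 2.
  pose phi x := sg x [set x] * f2 [set x].
  have [|h [hN hW]] := chordal_nbhd_extend e_sym e_irr 0 (phi := phi) chW vW.
    move=> x y xW yW evx evy exy.
    have ne_xy : x != y by apply: contraTneq exy => ->; rewrite e_irr.
    have xyN : [set x; y] \subset N.
      by rewrite subUset !sub1set !inE in xW yW *; rewrite xW yW evx.
    have := f2Z [set x; y] xyN (clique2 e_sym exy).
    rewrite cards2 ne_xy t2 => /(_ erefl).
    rewrite cobd_edge ?(subsetP (subset_trans WvW WW0)) //.
    move/(congr1 (fun z => edge_sg x y * z)); rewrite mulrA edge_sg2 mul1r mulr0.
    by move/eqP; rewrite subr_eq0 eq_sym => /eqP.
  exists (vcochain (fun x => if x == v then 0 else h x)) => X XW clX cX.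
  have XW0 := subset_trans XW WW0.
  have /cards2P[x [y [ne_xy EX]]] : #|X| == 2 by rewrite cX t2.
  have exy : e x y by move/cliqueP: clX; apply; rewrite ?EX ?set21 ?set22.
  have [xX yX] : x \in X /\ y \in X by rewrite EX set21 set22.
  have [xW yW] := (subsetP XW _ xX, subsetP XW _ yX).
  have key z : z \in W -> e v z -> f1 [set z; v] = 
      cobd (vcochain (fun x => if x == v then 0 else h x)) [set z; v].
    move=> zW evz; have ne_zv : z != v by apply: contraTneq evz => ->; rewrite e_irr.
    rewrite cobd_vcochain ?(subsetP WW0) // eqxx (negbTE ne_zv) hN ?inE ?ne_zv //.
    rewrite sub0r mulrN -mulNr -edge_sgN ?(subsetP WW0) // /phi /edge_sg /f2.
    rewrite (mulrA (_ * _)) -(mulrA (sg v _)) sg2 mulr1 mulrA sg2 mul1r.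
    by rewrite setUC.
  rewrite EX; have [xv|ne_xv] := eqVneq x v.
    by rewrite setUC xv; apply: key => //; rewrite -xv.
  have [yv|ne_yv] := eqVneq y v.
    by rewrite yv; apply: key => //; rewrite -yv e_sym.
  rewrite cobd_vcochain ?(subsetP WW0) // (negbTE ne_xv) (negbTE ne_yv).
  rewrite (hW x y) ?inE ?ne_xv ?ne_yv //= subrr mulr0 f10 -?EX //.
  by rewrite subsetD1 XW /= EX !inE !(eq_sym v) negb_or ne_xv ne_yv.
have [| | |h hE] := IHk N _ (subset_trans NW WW0) (chordal_sub NW chW) t.-1 f2.
- exact: leq_ltn_trans (subset_leq_card NWv) cardWv.
- by lia.
- move=> X XN clX cX; apply: f2Z => //; lia.
(* The cochain supported on the star of [v] whose link part is [- h]; the sign cancels the one in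
   [cobd_link]. *)
exists (fun X : {set T} => if v \in X then - (sg v X * h (X :\ v)) else 0) => X XW clX cX.
have XW0 := subset_trans XW WW0.
have [vX|vX] := boolP (v \in X); last first.
  rewrite f10 ?subsetD1 ?XW // /cobd big1 // => i iX.
  by rewrite inE (negbTE vX) andbF mulr0.
have [EX XvN clXv cXv] := decomp X XW clX vX cX.
rewrite {2}EX cobd_link -?EX // ?inE ?eqxx // sub0r mulrN.
rewrite {1}EX link_cochainE -EX -/f2 hE // -mulrN; congr (_ * _).
rewrite /cobd -sumrN; apply: eq_bigr => i.
rewrite inE => /andP[iv iX]; rewrite /link_cochain setU11 setU1K ?inE ?eqxx ?andbF //.
by rewrite mulrN mulrA sg2 mul1r mulrN opprK.
Qed.

(** * First cohomology of a cycle *)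

Section CycleCohomology.
Variables (m : nat) (s : nat -> T) (W : {set T}).
Hypotheses (m4 : (4 <= m)%N) (cs : icycle e m s).
Hypothesis WE : forall x, x \in W <-> exists2 i, (i < m)%N & x = s i.

Let s_inj i j : (i < m)%N -> (j < m)%N -> s i = s j -> i = j.
Proof. by case: cs => + _; apply. Qed.

Let es i j : (i < m)%N -> (j < m)%N -> e (s i) (s j) = cadj m i j.
Proof. by case: cs => _; apply. Qed.

Let sW i : (i < m)%N -> s i \in W.
Proof. by move=> im; apply/WE; exists i. Qed.

Lemma icycle_card : #|W| = m.
Proof.
have -> : W = [set s (i : 'I_m) | i in 'I_m].
  apply/setP => x; apply/idP/imsetP => [/WE[i im ->]|[i _ ->]].
    by exists (Ordinal im).
  by apply: sW.
rewrite card_in_imset ?card_ord // => i j _ _ /s_inj eq; apply: val_inj.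
by apply: eq.
Qed.

(** Since [m] is at least 4, the clique complex of the cycle has no 2-simplices, and every 1-cochain
    on it is a cocycle. *)
Lemma icycle_no_triangle (X : {set T}) : X \subset W -> clique e X -> #|X| = 3 -> False.
Proof.
move=> XW /cliqueP clX cX.
have /card_gt0P[x xX] : (0 < #|X|)%N by rewrite cX.
have /cards2P[y [z [yz EX]]] : #|X :\ x| == 2.
  by have := cardsD1 x X; rewrite xX cX; lia.
have := set21 y z; have := set22 y z; rewrite -EX !inE ![_ == x]eq_sym.
move=> /andP[xz zX] /andP[xy yX].
have /WE[i im xi] := subsetP XW x xX.
have /WE[j jm yj] := subsetP XW y yX.
have /WE[k km zk] := subsetP XW z zX.
have := clX x y xX yX xy; have := clX x z xX zX xz; have := clX y z yX zX yz.
rewrite xi yj zk !es // /cadj.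
have : i <> j by move=> E; rewrite xi yj E eqxx in xy.
have : i <> k by move=> E; rewrite xi zk E eqxx in xz.
have : j <> k by move=> E; rewrite yj zk E eqxx in yz.
lia.
Qed.

Hypothesis WW0 : W \subset W0.

(** The generator of the first cohomology: the indicator of the single edge whose removal turns the
    cycle into a path. *)
Definition closing_edge (X : {set T}) : K := (X == [set s 0; s m.-1])%:R.

Let edgeW (X : {set T}) : X \subset W -> clique e X -> #|X| = 2 ->
  (exists2 i, (i.+1 < m)%N & X = [set s i; s i.+1]) \/ X = [set s 0; s m.-1].
Proof.
move=> XW /cliqueP clX cX.
have /cards2P[x [y [ne_xy EX]]] : #|X| == 2 by rewrite cX.
have xX : x \in X by rewrite EX !inE eqxx.
have yX : y \in X by rewrite EX !inE eqxx orbT.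
have /WE[i im xi] := subsetP XW x xX.
have /WE[j jm yj] := subsetP XW y yX.
have := clX x y xX yX ne_xy; rewrite xi yj es //.
case/or4P => [/eqP ji|/eqP ij|/andP[i0 jm1]|/andP[j0 im1]].
- by left; exists i; rewrite -?ji // EX xi yj.
- by left; exists j; rewrite -?ij // EX xi yj setUC.
- by right; rewrite EX xi yj; congr [set s _; s _]; lia.
- by right; rewrite EX xi yj setUC; congr [set s _; s _]; lia.
Qed.

Let sW0 i : (i < m)%N -> s i \in W0.
Proof. by move/sW/(subsetP WW0). Qed.

Let s_neq i j : (i < m)%N -> (j < m)%N -> i != j -> s i != s j.
Proof. by move=> im jm; apply: contraNneq => /s_inj-> //. Qed.

Let edge_neq i : (i.+1 < m)%N -> ([set s i; s i.+1] == [set s 0; s m.-1]) = false.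
Proof.
move=> im; apply/eqP => E.
have := set21 (s i) (s i.+1); rewrite E !inE => /pred2P[] /s_inj Ei.
  have := set22 (s i) (s i.+1); rewrite E !inE => /pred2P[] /s_inj Ej; lia.
lia.
Qed.

(** Integrating [f] along the path from [s 0] (the partial sums [H]) gives a primitive on all edges
    but the closing one; [k] is the discrepancy there. *)
Lemma icycle_span f : exists k g, forall X : {set T},
  X \subset W -> clique e X -> #|X| = 2 -> f X - k * closing_edge X = cobd g X.
Proof.
pose H i := \sum_(l < i) edge_sg (s l) (s l.+1) * f [set s l; s l.+1].
pose h x := \sum_(i < m | s i == x) H i.
have hs i : (i < m)%N -> h (s i) = H i.
  move=> im; rewrite /h (bigD1 (Ordinal im)) //= big1 ?addr0 // => j /andP[/eqP sj].
  by case/eqP; apply: val_inj; apply: s_inj sj; rewrite ?ltn_ord.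
pose g := vcochain h; pose E0 := [set s 0; s m.-1].
exists (f E0 - cobd g E0), g => X XW clX cX; rewrite /closing_edge.
case: (edgeW XW clX cX) => [[i im ->]|->]; last by rewrite eqxx mulr1 opprB addrC subrK.
rewrite edge_neq // mulr0 subr0 cobd_vcochain ?sW0 ?s_neq //; try lia.
rewrite !hs //; last lia.
by rewrite /H big_ord_recr /= addrAC subrr add0r mulrA edge_sg2 mul1r.
Qed.

(** The coboundary vanishes on the path, so the signed values of [g] are constant along it, and the
    coboundary vanishes on the closing edge too. *)
Lemma icycle_indep k g :
  (forall X : {set T}, X \subset W -> clique e X -> #|X| = 2 ->
     k * closing_edge X = cobd g X) -> k = 0.
Proof.
move=> kE; pose h x := sg x [set x] * g [set x].
have edge i j : (i < m)%N -> (j < m)%N -> cadj m i j -> i != j ->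
    k * closing_edge [set s i; s j] = edge_sg (s i) (s j) * (h (s j) - h (s i)).
  move=> im jm ij ne_ij; rewrite -cobd_edge ?sW0 ?s_neq //; apply: kE.
  - by rewrite subUset !sub1set !sW.
  - by apply: clique2 => //; rewrite es.
  - by rewrite cards2 s_neq.
have hc i : (i < m)%N -> h (s i) = h (s 0).
  elim: i => // i IHi im; rewrite -IHi; last lia.
  have adj : cadj m i i.+1 by rewrite /cadj eqxx.
  have := edge i i.+1 (ltnW im) im adj; rewrite /closing_edge edge_neq // mulr0.
  rewrite neq_ltn ltnSn => /(_ isT)/esym.
  move/(congr1 (fun z => edge_sg (s i) (s i.+1) * z)).
  by rewrite mulrA edge_sg2 mul1r mulr0 => /eqP; rewrite subr_eq0 => /eqP.
have m1 : (m.-1 < m)%N by lia.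
have := edge 0 m.-1; rewrite /closing_edge eqxx mulr1 (hc m.-1 m1) subrr mulr0.
by apply=> //; rewrite /cadj; lia.
Qed.

End CycleCohomology.

End Cochains.

(** * The Koszul complex *)

Section SimplexBoundary.
Variables (K : fieldType) (n : nat).
Implicit Types (S U : {set 'I_n}) (f g : {set 'I_n} -> K).

Definition sgn (i : 'I_n) S : K := (-1) ^+ #|[set j in S | (j < i)%N]|.

Lemma sgn2 i S : sgn i S * sgn i S = 1.
Proof. by rewrite /sgn -expr2 sqrr_sign. Qed.

Lemma sgnU1 i k S : k \notin S -> sgn i (k |: S) = (-1) ^+ (k < i)%N * sgn i S.
Proof.
move=> kS; rewrite /sgn -exprD; congr (_ ^+ _).
case: ltnP => lt_ki /=.
  rewrite [LHS](cardsD1 k) !inE eqxx lt_ki /=; congr (_ + #|pred_of_set _|)%N.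
  apply/setP => j; rewrite !inE; case: eqVneq => [->|] //=.
  by rewrite (negbTE kS).
congr #|pred_of_set _|; apply/setP => j; rewrite !inE; case: eqVneq => [->|] //=.
by rewrite ltnNge lt_ki andbF.
Qed.

Lemma sgnA i k S : i != k -> i \notin S -> k \notin S ->
  sgn i S * sgn k (i |: S) = - (sgn k S * sgn i (k |: S)).
Proof.
move=> ne_ik iS kS; rewrite !sgnU1 // mulrCA [sgn k S * _]mulrCA.
rewrite [sgn k S * _]mulrC -mulNr; congr (_ * _).
case: (ltngtP i k) => [_|_|/val_inj E]; rewrite ?expr1 ?expr0 ?opprK //.
by rewrite E eqxx in ne_ik.
Qed.

Lemma sgnC i k S : i != k -> i \notin S -> k \notin S ->
  sgn k (i |: S) * sgn i (k |: S) = - (sgn i S * sgn k S).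
Proof.
move=> ne_ik iS kS; rewrite !sgnU1 // mulrACA [sgn k S * _]mulrC -[RHS]mulN1r.
congr (_ * _); case: (ltngtP i k) => [_|_|/val_inj E].
- by rewrite expr1 expr0 mulr1.
- by rewrite expr1 expr0 mul1r.
by rewrite E eqxx in ne_ik.
Qed.

(** The Koszul differential on coefficient functions, with the variables set to 1: within one
    multidegree the monomials are determined by [S]. *)
Definition bdry f S : K := \sum_(i | i \notin S) sgn i S * f (i |: S).

Lemma bdry_bdry f S : bdry (bdry f) S = 0.
Proof.
rewrite -[RHS](@antisymmetric_sum _ _ (~: S)
  (fun i j => sgn i S * sgn j (i |: S) * f (j |: (i |: S)))).
  apply: eq_big => [i|i iS]; first by rewrite inE.
  rewrite /bdry mulr_sumr; apply: eq_big => [j|j _]; last by rewrite mulrA.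
  by rewrite !inE negb_or.
move=> i j; rewrite !inE => iS jS ne_ij; rewrite sgnA // mulNr.
by rewrite setUCA.
Qed.

(* Coning with i is a contracting homotopy. *)
Lemma cone_acyclic U (L : pred {set 'I_n}) i f :
  i \in U ->
  (forall S, L S -> L (S :\ i)) ->
  (forall S, ~~ (S \subset U) -> f S = 0) ->
  (forall S, L S -> bdry f S = 0) ->
  exists g, (forall S, ~~ (S \subset U) -> g S = 0) /\
            (forall S, L S -> f S = bdry g S).
Proof.
move=> iU Li fU fZ.
(* The exterior product of [f] with the basis element of [i]. *)
exists (fun S => if i \in S then sgn i (S :\ i) * f (S :\ i) else 0); split.
  move=> S SU; case: ifP => // iS; rewrite fU ?mulr0 //.
  by apply: contra SU => SU; rewrite -(setD1K iS) subUset sub1set iU.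
move=> S LS; rewrite /bdry; have [iS|iS] := boolP (i \in S); last first.
  rewrite (bigD1 i) //= setU11 setU1K // mulrA sgn2 mul1r big1 ?addr0 //.
  by move=> k /andP[kS ne_ki]; rewrite !inE eq_sym (negbTE ne_ki) (negbTE iS) mulr0.
(* The cycle condition at [S :\ i], available because [L] is stable under removing [i], expresses
   [f S] by the terms of [bdry g S]. *)
have := fZ _ (Li _ LS); set S0 := S :\ i.
have ES : S = i |: S0 by rewrite setD1K.
have iS0 : i \notin S0 by rewrite !inE eqxx.
rewrite /bdry (bigD1 i) //= -ES => /eqP; rewrite addr_eq0 => /eqP E.
have -> : f S = sgn i S0 * (sgn i S0 * f S) by rewrite mulrA sgn2 mul1r.
rewrite E mulrN mulr_sumr -sumrN.
apply: eq_big => [k|k /andP[kS0 ne_ki]].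
  by rewrite ES !inE negb_or andbC.
rewrite !inE iS orbT.
have -> : (k |: S) :\ i = k |: S0.
  by rewrite setDUl; congr (_ :|: _); apply/setDidPl; rewrite disjoints1 inE.
rewrite !mulrA -mulNr; congr (_ * _).
by rewrite ES sgnC // eq_sym.
Qed.

End SimplexBoundary.

Section Multidegrees.
Variables (K : fieldType) (n : nat).
Local Notation R := {mpoly K[n]}.
Implicit Types (S : {set 'I_n}) (a m : 'X_{1..n}) (c : {set 'I_n} -> R).

Definition mnm_supp a : {set 'I_n} := [set i | (0 < a i)%N].

Definition mnm_set S : 'X_{1..n} := [multinom (i \in S : nat) | i < n].

Lemma mnm_setE S i : mnm_set S i = (i \in S).
Proof. by rewrite mnmE. Qed.

Lemma mnm_set0 : mnm_set set0 = 0%MM.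
Proof. by apply/mnmP => i; rewrite mnm_setE mnm0E inE. Qed.

Lemma mdeg_mnm_set S : mdeg (mnm_set S) = #|S|.
Proof.
rewrite mdegE -sum1_card [RHS]big_mkcond /=; apply: eq_bigr => i _.
by rewrite mnm_setE; case: (i \in S).
Qed.

Lemma mnm_set_le S a : (mnm_set S <= a)%MM = (S \subset mnm_supp a).
Proof.
apply/mnm_lepP/subsetP => [le_Sa i iS | sub_Sa i].
  by have := le_Sa i; rewrite mnm_setE iS inE.
by rewrite mnm_setE; case: (boolP (i \in S)) => // /sub_Sa; rewrite inE.
Qed.

Lemma mnm_set_inj : injective mnm_set.
Proof.
move=> S S' /mnmP E; apply/setP => i; have := E i; rewrite !mnm_setE.
by do 2!case: (i \in _).
Qed.

Lemma mnm_supp_set S : mnm_supp (mnm_set S) = S.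
Proof. by apply/setP => i; rewrite inE mnm_setE; case: (i \in S). Qed.

Lemma mnm_supp_addr_set m S : S \subset mnm_supp (m + mnm_set S).
Proof. by apply/subsetP => i iS; rewrite inE mnmDE mnm_setE iS addn1. Qed.

Lemma mcoeffXM (i : 'I_n) (p : R) m :
  ('X_i * p)@_m = if (0 < m i)%N then p@_(m - U_(i)) else 0.
Proof.
rewrite mulrC; case: ifP => mi.
  have le_im : (U_(i) <= m)%MM by rewrite lep1mP -lt0n.
  by rewrite -{1}(submK le_im) addmC mcoeffMX.
apply/eqP; rewrite mcoeff_eq0 (perm_mem (msuppMX _ _)).
apply/mapP => -[m' _ E]; move: mi; rewrite E mnmDE mnm1E eqxx; lia.
Qed.

Definition koszul c S : R :=
  \sum_(i | i \notin S) (sgn K i S)%:MP * 'X_i * c (i |: S).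

(* The strand of the Koszul chain c in multidegree a: the basis element e_S
   with coefficient x^m has multidegree m + S. *)
Definition strand a c S : K :=
  if S \subset mnm_supp a then (c S)@_(a - mnm_set S) else 0.

Lemma strandD_set m c S : strand (m + mnm_set S) c S = (c S)@_m.
Proof. by rewrite /strand mnm_supp_addr_set addmK. Qed.

Lemma strand_supp a c S : ~~ (S \subset mnm_supp a) -> strand a c S = 0.
Proof. by rewrite /strand => /negbTE->. Qed.

Lemma strand_koszul a c S : strand a (koszul c) S = bdry (strand a c) S.
Proof.
rewrite {1}/strand /bdry; case: ifP => Sa; last first.
  rewrite big1 // => i _; rewrite strand_supp ?mulr0 //.
  by rewrite subUset Sa andbF.
rewrite raddf_sum; apply: eq_bigr => i iS /=.
rewrite -mulrA mcoeffCM mcoeffXM; congr (_ * _).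
rewrite mnmBE mnm_setE (negbTE iS) subn0 /strand subUset sub1set Sa andbT inE.
case: ifP => // ai; congr (_ @_ _); apply/mnmP => k.
rewrite !mnmBE !mnm_setE mnm1E !inE; case: (eqVneq i k) => [<-|ne_ik].
  by rewrite (negbTE iS) subn0.
by rewrite subn0.
Qed.

(* P stands for the set of monomials of a monomial ideal. *)
Lemma koszul_assemble (P : pred 'X_{1..n}) c :
  (forall a, exists g : {set 'I_n} -> K,
     (forall S, ~~ (S \subset mnm_supp a) -> g S = 0) /\
     (forall S, S \subset mnm_supp a -> ~~ P (a - mnm_set S)%MM ->
        strand a c S = bdry g S)) ->
  exists b : {set 'I_n} -> R,
    forall S m, ~~ P m -> (c S)@_m = (koszul b S)@_m.
Proof.
move=> H.
(* A bound beyond which all strands of [c] vanish; it reduces the choice of the local primitives to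
   a finite type. *)
pose N := (\max_S (msize (c S) + #|S|)).+1.
have [G GE] := fin_all_exists (fun a : 'X_{1..n < N} => H a).
pose b S : R := \sum_(a : 'X_{1..n < N} | S \subset mnm_supp a)
   (G a S) *: 'X_[a - mnm_set S].
have bE (a : 'X_{1..n < N}) S : strand a b S = G a S.
  have [Ga _] := GE a; rewrite /strand; case: ifP => Sa; last by rewrite Ga ?Sa.
  rewrite /b raddf_sum /= (bigD1 a) //= mcoeffZ mcoeffX eqxx mulr1 big1 ?addr0 //.
  move=> a' /andP[Sa' ne_aa']; rewrite mcoeffZ mcoeffX; case: eqP; rewrite ?mulr0 //.
  move=> E; case/eqP: ne_aa'; apply/val_inj => /=.
  by rewrite -(@submK _ (mnm_set S) a') ?mnm_set_le // E submK // mnm_set_le.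
have b0 a S : (N <= mdeg a)%N -> strand a b S = 0.
  move=> Na; rewrite /strand; case: ifP => // Sa; rewrite /b raddf_sum /= big1 //.
  move=> a' Sa'; rewrite mcoeffZ mcoeffX; case: eqP; rewrite ?mulr0 //.
  move=> E; have := bmdeg a'.
  have -> : bmnm a' = a.
    by rewrite -(@submK _ (mnm_set S) a') ?mnm_set_le // E submK // mnm_set_le.
  by rewrite ltnNge Na.
exists b => S m Pm; rewrite -!strandD_set strand_koszul.
have [lt_aN|le_Na] := ltnP (mdeg (m + mnm_set S)) N.
  pose a : 'X_{1..n < N} := BMultinom lt_aN.
  have -> : (m + mnm_set S)%MM = a by [].
  have [_ ->] := GE a; rewrite /= ?mnm_supp_addr_set ?addmK //.
  by apply: eq_bigr => i _; rewrite -[strand _ b _]/(strand a b _) bE.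
rewrite /bdry big1 => [|i _]; last by rewrite b0 ?mulr0.
rewrite strandD_set; apply/eqP; rewrite mcoeff_eq0; apply/negP => /msize_mdeg_lt.
move: le_Na; rewrite mdegD mdeg_mnm_set /N.
have := leq_bigmax (F := fun S => (msize (c S) + #|S|)%N) S; lia.
Qed.

Lemma koszul_koszul c S : koszul (koszul c) S = 0.
Proof.
apply/mpolyP => m; rewrite -strandD_set strand_koszul mcoeff0.
rewrite -[RHS](bdry_bdry (strand (m + mnm_set S) c) S).
by apply: eq_bigr => i _; rewrite strand_koszul.
Qed.

(** A multidegree other than 0 involves some variable, which gives a cone. In multidegree 0 only the
    constant term at [set0] occurs, and the second hypothesis kills it. *)
Lemma koszul_exact c :
  (forall S, koszul c S = 0) -> (c set0)@_0%MM = 0 ->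
  exists b, forall S, c S = koszul b S.
Proof.
move=> cZ c0.
have [|b bE] := @koszul_assemble pred0 c; last first.
  by exists b => S; apply/mpolyP => m; apply: bE.
move=> a; have [a0|[i ia]] := set_0Vmem (mnm_supp a).
  exists (fun=> 0); split=> // S; rewrite a0 subset0 => /eqP-> _.
  rewrite /bdry big1 => [|i _]; last by rewrite mulr0.
  rewrite /strand sub0set mnm_set0; suff -> : (a - 0)%MM = 0%MM by [].
  apply/mnmP => i; rewrite mnmBE mnm0E; have /setP/(_ i) := a0; rewrite !inE; lia.
have [| | |g [gU gE]] := cone_acyclic (U := mnm_supp a)
  (L := fun S => S \subset mnm_supp a) (f := strand a c) ia.
- by move=> S; apply: subset_trans; apply: subsetDl.
- exact: strand_supp.
- by move=> S Sa; rewrite -strand_koszul /strand cZ mcoeff0 if_same.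
- by exists g; split=> // S Sa _; apply: gE.
Qed.

End Multidegrees.

Section KoszulComplex.
Variables (K : fieldType) (n : nat).
Local Notation R := {mpoly K[n]}.
Implicit Types S : {set 'I_n}.

Local Notation kchain m := {ffun {set 'I_n} -> 'rV[R]_m}.

Definition kdiff m (c : kchain m) : kchain m :=
  [ffun S : {set 'I_n} => \sum_(i | i \notin S) ((sgn K i S)%:MP * 'X_i) *: c (i |: S)].

Definition kmap m m' (A : 'M[R]_(m, m')) (c : kchain m) : kchain m' :=
  [ffun S : {set 'I_n} => c S *m A].

Lemma kdiffE m (c : kchain m) S k :
  kdiff c S 0 k = koszul (fun S' => c S' 0 k) S.
Proof.
by rewrite ffunE summxE; apply: eq_bigr => i _; rewrite mxE.
Qed.

Lemma kchainP m (c c' : kchain m) : (forall S k, c S 0 k = c' S 0 k) -> c = c'.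
Proof. by move=> E; apply/ffunP => S; apply/rowP => k. Qed.

Lemma kdiff_is_linear m : linear (@kdiff m).
Proof.
move=> x c c'; apply/ffunP => S; rewrite !ffunE scaler_sumr -big_split.
by apply: eq_bigr => i _; rewrite !ffunE scalerDr !scalerA mulrC.
Qed.
HB.instance Definition _ m :=
  GRing.isLinear.Build R (kchain m) (kchain m) _ (@kdiff m) (@kdiff_is_linear m).

Lemma kmap_is_linear m m' (A : 'M[R]_(m, m')) : linear (kmap A).
Proof.
move=> x c c'; apply/ffunP => S.
by rewrite !ffunE mulmxDl -scalemxAl.
Qed.
HB.instance Definition _ m m' (A : 'M[R]_(m, m')) :=
  GRing.isLinear.Build R (kchain m) (kchain m') _ (kmap A) (kmap_is_linear A).

Lemma kdiffP m x (c c' : kchain m) : kdiff (x *: c + c') = x *: kdiff c + kdiff c'.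
Proof. exact: kdiff_is_linear. Qed.

Lemma kmapP m m' (A : 'M[R]_(m, m')) x c c' :
  kmap A (x *: c + c') = x *: kmap A c + kmap A c'.
Proof. exact: kmap_is_linear. Qed.

Lemma kdiff_kdiff m (c : kchain m) : kdiff (kdiff c) = 0.
Proof.
apply: kchainP => S k; rewrite kdiffE !(ffunE, mxE).
rewrite -[RHS](koszul_koszul (fun S' => c S' 0 k) S).
by apply: eq_bigr => i _; rewrite kdiffE.
Qed.

Lemma kdiff_kmap m m' (A : 'M[R]_(m, m')) c : kdiff (kmap A c) = kmap A (kdiff c).
Proof.
apply/ffunP => S; rewrite !ffunE mulmx_suml; apply: eq_bigr => i _.
by rewrite !ffunE scalemxAl.
Qed.

Lemma kdiff_exact m (c : kchain m) :
  kdiff c = 0 -> (forall k, (c set0 0 k)@_0%MM = 0) -> exists b, c = kdiff b.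
Proof.
move=> cZ c0; have H k : exists b, forall S, c S 0 k = koszul b S.
  by apply: koszul_exact => // S; rewrite -kdiffE cZ ffunE mxE.
have [b bE] := fin_all_exists H.
exists [ffun S : {set 'I_n} => \row_k b k S]; apply: kchainP => S k; rewrite kdiffE bE.
by apply: eq_bigr => i _; rewrite ffunE mxE.
Qed.

End KoszulComplex.

(** * Betti numbers as Koszul homology *)

Section QuotientBasis.
Variables (K : fieldType) (R : nzRingType) (io : {rmorphism K -> R}).

Definition subsp (V : lmodType R) (P : V -> Prop) : Prop :=
  P 0 /\ forall x u v, P u -> P v -> P (io x *: u + v).

(* The c k, k in J, form a K-basis of Z modulo B. *)
Definition qbasis (V : lmodType R) (Z B : V -> Prop) (T : finType)
    (J : {set T}) (c : T -> V) : Prop :=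
  [/\ forall k, k \in J -> Z (c k),
      forall z, Z z -> exists x : T -> K, B (z - \sum_(k in J) io (x k) *: c k)
    & forall x : T -> K, B (\sum_(k in J) io (x k) *: c k) ->
        forall k, k \in J -> x k = 0].

Lemma subsp_sum (V : lmodType R) (P : V -> Prop) (T : finType) (J : {set T})
    (x : T -> K) (c : T -> V) :
  subsp P -> (forall k, k \in J -> P (c k)) -> P (\sum_(k in J) io (x k) *: c k).
Proof.
move=> [P0 PD] Pc; elim/big_rec: _ => // k y kJ Py.
by apply: PD => //; apply: Pc.
Qed.

Lemma subspB (V : lmodType R) (P : V -> Prop) u v :
  subsp P -> P u -> P v -> P (u - v).
Proof.
move=> [P0 PD] Pu Pv; rewrite addrC.
by have := PD (-1) v u Pv Pu; rewrite rmorphN1 scaleN1r.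
Qed.

(** Expand the [c] in the [c'] modulo [B]: a left kernel vector of the coefficient matrix would be a
    relation among the [c] modulo [B], so its rows are independent. *)
Lemma qbasis_leq (V : lmodType R) (Z B : V -> Prop) (T T' : finType)
    (J : {set T}) (J' : {set T'}) c c' :
  subsp B -> qbasis Z B J c -> qbasis Z B J' c' -> (#|J| <= #|J'|)%N.
Proof.
move=> sB [cZ _ cI] [_ c'S _].
have H (i : 'I_#|J|) : exists x : T' -> K,
    B (c (enum_val i) - \sum_(k in J') io (x k) *: c' k).
  by apply: c'S; apply: cZ; apply: enum_valP.
have [x xE] := fin_all_exists H.
pose M : 'M[K]_(#|J|, #|J'|) := \matrix_(i, k) x i (enum_val k).
suff : row_free M by rewrite /row_free => /eqP <-; apply: rank_leq_col.
apply: inj_row_free => u uM; apply/rowP => i; rewrite mxE.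
have [i0 i0J] : exists i0, i0 \in J by exists (enum_val i); apply: enum_valP.
pose y k := u 0 (enum_rank_in i0J k).
have yE i' : y (enum_val i') = u 0 i' by rewrite /y enum_valK_in.
rewrite -yE; apply: cI (enum_valP i).
have -> : \sum_(k in J) io (y k) *: c k =
    \sum_i' io (u 0 i') *: (c (enum_val i') - \sum_(k in J') io (x i' k) *: c' k).
  rewrite (eq_bigr _ (fun i' _ => scalerBr _ _ _)) sumrB.
  rewrite [X in _ - X](_ : _ = 0) ?subr0.
    by rewrite big_enum_val; apply: eq_bigr => i' _; rewrite yE.
  rewrite (eq_bigr _ (fun i' _ => scaler_sumr _ _ _ _)) exchange_big /= big1 // => k kJ'.
  rewrite (eq_bigr (fun i' => io (u 0 i' * x i' k) *: c' k)); last first.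
    by move=> i' _; rewrite scalerA rmorphM.
  rewrite -scaler_suml -rmorph_sum.
  have := congr1 (fun A : 'rV_ _ => A 0 (enum_rank_in kJ' k)) uM.
  rewrite !mxE (eq_bigr (fun i' => u 0 i' * x i' k)).
    by move=> ->; rewrite rmorph0 scale0r.
  by move=> i' _; rewrite mxE enum_rankK_in.
elim/big_rec: _ => [|i' v _ Bv]; first by case: sB.
by case: (sB) => _; apply.
Qed.

Lemma qbasis_card (V : lmodType R) (Z B : V -> Prop) (T T' : finType)
    (J : {set T}) (J' : {set T'}) c c' :
  subsp B -> qbasis Z B J c -> qbasis Z B J' c' -> #|J| = #|J'|.
Proof.
move=> sB qJ qJ'; apply/eqP; rewrite eqn_leq.
by rewrite (qbasis_leq sB qJ qJ') (qbasis_leq sB qJ' qJ).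
Qed.

(* A linear relation rho inducing an isomorphism between Z / B and Z' / B'. *)
Lemma qbasis_transport (V V' : lmodType R) (Z B : V -> Prop) (Z' B' : V' -> Prop)
    (rho : V -> V' -> Prop) (T : finType) (J : {set T}) c' :
  subsp Z -> subsp Z' ->
  rho 0 0 ->
  (forall x u v u' v', rho u u' -> rho v v' ->
     rho (io x *: u + v) (io x *: u' + v')) ->
  (forall z, Z z -> exists2 z', Z' z' & rho z z') ->
  (forall z', Z' z' -> exists2 z, Z z & rho z z') ->
  (forall z z', Z z -> Z' z' -> rho z z' -> (B z <-> B' z')) ->
  qbasis Z' B' J c' -> exists c, qbasis Z B J c.
Proof.
move=> sZ sZ' rho0 rhoD tot surj rhoB [c'Z c'S c'I].
have H k : exists z, k \in J -> Z z /\ rho z (c' k).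
  case: (boolP (k \in J)) => kJ; last by exists 0.
  by have [z Zz rz] := surj _ (c'Z k kJ); exists z.
have [c cE] := fin_all_exists H; exists c.
have cZ k : k \in J -> Z (c k) by case/cE.
have rho_sum x : rho (\sum_(k in J) io (x k) *: c k) (\sum_(k in J) io (x k) *: c' k).
  by elim/big_rec2: _ => // k y1 y2 kJ ry; apply: rhoD => //; case: (cE k kJ).
split=> //.
  move=> z Zz; have [z' Zz' rz] := tot z Zz; have [x Bx] := c'S z' Zz'.
  exists x; apply/(rhoB _ (z' - \sum_(k in J) io (x k) *: c' k)) => //.
  - by apply: subspB => //; apply: subsp_sum.
  - by apply: subspB => //; apply: subsp_sum.
  - have := rhoD (-1) _ _ _ _ (rho_sum x) rz.
    by rewrite rmorphN1 !scaleN1r addrC [X in rho _ X]addrC.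
move=> x Bx; apply: c'I; apply/(rhoB _ _ _ _ (rho_sum x)) => //; exact: subsp_sum.
Qed.

End QuotientBasis.

Section Truncation.
Variables (K : fieldType) (n : nat).
Local Notation R := {mpoly K[n]}.

Definition mtrunc (P : pred 'X_{1..n}) (p : R) : R :=
  \sum_(m <- msupp p | P m) p@_m *: 'X_[m].

Lemma mcoeff_mtrunc P p m : (mtrunc P p)@_m = if P m then p@_m else 0.
Proof.
rewrite /mtrunc raddf_sum /=.
have [mp|mp] := boolP (m \in msupp p); last first.
  rewrite (memN_msupp_eq0 mp) if_same big_seq_cond big1 // => m' /andP[m'p _].
  rewrite mcoeffZ mcoeffX; case: eqP => [E|_]; rewrite ?mulr0 //.
  by rewrite E (negbTE mp) in m'p.
rewrite big_mkcond (bigD1_seq m) ?msupp_uniq //= big1 => [|m' ne_m'm].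
  by rewrite addr0 mcoeffZ mcoeffX eqxx mulr1; case: ifP; rewrite ?mcoeff0.
by case: ifP => // _; rewrite mcoeffZ mcoeffX (negbTE ne_m'm) mulr0.
Qed.

(** For homogeneous [q] the condition [P'] is [P] shifted by the degree of [q]; this makes graded
    maps commute with truncation. *)
Lemma mtruncM (P P' : pred 'X_{1..n}) (p q : R) :
  (forall m m', m' \in msupp q -> P (m + m')%MM = P' m) ->
  mtrunc P (p * q) = mtrunc P' p * q.
Proof.
move=> PP'; apply/mpolyP => m; rewrite mcoeff_mtrunc !mcoeffM.
case: ifP => Pm.
  apply: eq_bigr => -[k1 k2] /= /eqP E; rewrite mcoeff_mtrunc.
  have [k2q|k2q] := boolP (bmnm k2 \in msupp q).
    by rewrite -(PP' _ _ k2q) -E Pm.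
  by rewrite (memN_msupp_eq0 k2q) !mulr0.
rewrite big1 // => -[k1 k2] /= /eqP E; rewrite mcoeff_mtrunc.
have [k2q|k2q] := boolP (bmnm k2 \in msupp q).
  by rewrite -(PP' _ _ k2q) -E Pm mul0r.
by rewrite (memN_msupp_eq0 k2q) !mulr0.
Qed.

Lemma mtrunc_sum (P : pred 'X_{1..n}) (I : finType) (Q : pred I) (F : I -> R) :
  mtrunc P (\sum_(i | Q i) F i) = \sum_(i | Q i) mtrunc P (F i).
Proof.
apply/mpolyP => m; rewrite mcoeff_mtrunc !raddf_sum /=.
under [RHS]eq_bigr => i _ do rewrite mcoeff_mtrunc.
by case: ifP => _ //; rewrite big1.
Qed.

End Truncation.

Section BettiNumbers.
Variables (K : fieldType) (n : nat) (F : free_sequence K n).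
Local Notation R := {mpoly K[n]}.
Local Notation kchain m := {ffun {set 'I_n} -> 'rV[R]_m}.
Implicit Types (S : {set 'I_n}) (q p j : nat).

(* F extended by the ring itself: index 0 is R, index q.+1 is F_q. *)
Definition aug_rank q : nat := if q is q'.+1 then res_rank F q' else 1.

Definition aug_deg q : 'I_(aug_rank q) -> nat :=
  match q with 0 => fun=> 0%N | q'.+1 => @res_deg _ _ F q' end.

Definition aug_diff q : 'M[R]_(aug_rank q.+1, aug_rank q) :=
  match q with 0 => res_aug F | q'.+1 => res_diff F q' end.

Hypothesis F_graded : forall q k l,
  homog_diff (aug_deg k) (aug_deg l) (aug_diff q k l).
Hypothesis F_exact : forall q (v : 'rV_(aug_rank q.+1)),
  v *m aug_diff q = 0 <-> exists w, v = w *m aug_diff q.+1.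
Hypothesis F_minimal : forall q k l, (aug_diff q k l)@_0%MM = 0.

Lemma kchainBE m (c c' : kchain m) S k : (c - c') S 0 k = c S 0 k - c' S 0 k.
Proof. by rewrite !ffunE !mxE. Qed.

Lemma kchainDE m (c c' : kchain m) S k : (c + c') S 0 k = c S 0 k + c' S 0 k.
Proof. by rewrite !ffunE !mxE. Qed.

Definition bidegree q p j (c : kchain (aug_rank q)) : Prop :=
  forall S k m, m \in msupp (c S 0 k) ->
    #|S| = p /\ (mdeg m + #|S| + aug_deg k)%N = j.

(* Koszul cycles and boundaries in K(x; coker (aug_diff q)), lifted to F. *)
Definition tor_cycle q p j (c : kchain (aug_rank q)) : Prop :=
  bidegree p j c /\ exists y, kdiff c = kmap (aug_diff q) y.

Definition tor_boundary q (c : kchain (aug_rank q)) : Prop :=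
  exists b y, c = kdiff b + kmap (aug_diff q) y.

(** Preimages supplied by exactness need not be homogeneous; this projection makes them so. *)
Definition ktrunc q p j (c : kchain (aug_rank q)) : kchain (aug_rank q) :=
  [ffun S : {set 'I_n} => \row_k mtrunc
     (fun m => (#|S| == p) && (mdeg m + #|S| + aug_deg k == j)%N) (c S 0 k)].

Lemma ktrunc_id q p j (c : kchain (aug_rank q)) : bidegree p j c -> ktrunc p j c = c.
Proof.
move=> cg; apply: kchainP => S k; rewrite ffunE mxE; apply/mpolyP => m.
rewrite mcoeff_mtrunc; case: ifP => // E; apply/esym/eqP; rewrite mcoeff_eq0.
by apply/negP => /cg [Sp mj]; rewrite mj Sp !eqxx in E.
Qed.

Lemma bidegree_ktrunc q p j (c : kchain (aug_rank q)) : bidegree p j (ktrunc p j c).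
Proof.
move=> S k m; rewrite ffunE mxE mcoeff_msupp mcoeff_mtrunc.
by case: ifP => [/andP[/eqP -> /eqP ->]|] //; rewrite eqxx.
Qed.

Lemma kdiff_ktrunc q p j (c : kchain (aug_rank q)) :
  kdiff (ktrunc p.+1 j c) = ktrunc p j (kdiff c).
Proof.
apply: kchainP => S k; rewrite kdiffE ffunE mxE kdiffE /koszul mtrunc_sum.
apply: eq_bigr => i iS; rewrite ffunE mxE mulrC [in RHS]mulrC.
apply/esym/mtruncM => m m'; rewrite mcoeff_msupp mcoeffCM mcoeffX.
case: (U_(i)%MM =P m') => [<- _|_]; last by rewrite mulr0 eqxx.
rewrite mdegD mdeg1 cardsU1 iS; congr (_ && _); lia.
Qed.

Lemma kmap_ktrunc q p j (y : kchain (aug_rank q.+1)) :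
  kmap (aug_diff q) (ktrunc p j y) = ktrunc p j (kmap (aug_diff q) y).
Proof.
apply: kchainP => S l; rewrite !ffunE !mxE mtrunc_sum; apply: eq_bigr => k _.
rewrite mxE; apply/esym/mtruncM => m m' /F_graded.
rewrite mdegD; move: (aug_deg k) (aug_deg l) => dk dl; lia.
Qed.

Lemma kmap_mcoeff0 q (y : kchain (aug_rank q.+1)) S l :
  (kmap (aug_diff q) y S 0 l)@_0%MM = 0.
Proof.
rewrite ffunE mxE raddf_sum big1 //= => k _.
by rewrite (rmorphM (mcoeff 0%MM)) /= F_minimal mulr0.
Qed.

Lemma kmap_exact q (y : kchain (aug_rank q.+1)) :
  kmap (aug_diff q) y = 0 <-> exists w, y = kmap (aug_diff q.+1) w.
Proof.
split=> [y0|[w ->]]; last first.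
  apply/ffunP => S; rewrite !ffunE; apply/F_exact; by exists (w S).
have H S : exists w, y S = w *m aug_diff q.+1.
  by apply/F_exact; have /ffunP/(_ S) := y0; rewrite !ffunE.
have [w wE] := fin_all_exists H; exists (finfun w); apply/ffunP => S.
by rewrite !ffunE wE.
Qed.

Local Notation io := (@mpolyC n K).
Lemma subsp_tor_cycle q p j : subsp io (@tor_cycle q p j).
Proof.
split.
  split; last by exists 0; rewrite !raddf0.
  by move=> S k m; rewrite ffunE mxE mcoeff_msupp mcoeff0 eqxx.
move=> x u v [ug [y uy]] [vg [z vz]]; split; last first.
  by exists (io x *: y + z); rewrite kdiffP kmapP uy vz.
move=> S k m; rewrite mcoeff_msupp !ffunE !mxE mcoeffD mcoeffCM.
have [/ug //|mu] := boolP (m \in msupp (u S 0 k)).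
rewrite (memN_msupp_eq0 mu) mulr0 add0r -mcoeff_msupp; exact: vg.
Qed.

Lemma subsp_tor_boundary q : subsp io (@tor_boundary q).
Proof.
split; first by exists 0, 0; rewrite !raddf0 addr0.
move=> x u v [b [y ->]] [b' [y' ->]]; exists (io x *: b + b'), (io x *: y + y').
by rewrite kdiffP kmapP scalerDr addrACA.
Qed.

(** Let M_q be the cokernel of [aug_diff q]. The relation is the connecting map of 0 -> M_(q+1) ->
    free -> M_q -> 0. It is bijective because a free module has Koszul homology only in degree 0,
    where minimality makes the map from M_(q+1) vanish. *)
Lemma tor_shift q p j (T : finType) (J : {set T}) c' :
  qbasis io (@tor_cycle q.+1 p j) (@tor_boundary q.+1) J c' ->
  exists c, qbasis io (@tor_cycle q p.+1 j) (@tor_boundary q) J c.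
Proof.
apply: (qbasis_transport (rho := fun c c' => kdiff c = kmap (aug_diff q) c')).
- exact: subsp_tor_cycle.
- exact: subsp_tor_cycle.
- by rewrite !raddf0.
- by move=> x u v u' v' E1 E2; rewrite kdiffP kmapP E1 E2.
- move=> c [cg [y cy]]; exists (ktrunc p j y); last first.
    by rewrite kmap_ktrunc -cy -kdiff_ktrunc ktrunc_id.
  split; first exact: bidegree_ktrunc.
  apply/kmap_exact; rewrite -kdiff_kmap kmap_ktrunc -cy -kdiff_ktrunc ktrunc_id //.
  exact: kdiff_kdiff.
(* Surjectivity: the image of [c1] in the free module is a Koszul cycle without constant term, by
   minimality, so it bounds. *)
- move=> c1 [cg [y cy]].
  have [|k|b bE] := @kdiff_exact _ _ _ (kmap (aug_diff q) c1).
  + by rewrite kdiff_kmap cy; apply/kmap_exact; exists y.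
  + exact: kmap_mcoeff0.
  have E : kdiff (ktrunc p.+1 j b) = kmap (aug_diff q) c1.
    by rewrite kdiff_ktrunc -bE -kmap_ktrunc ktrunc_id.
  exists (ktrunc p.+1 j b) => //; split; first exact: bidegree_ktrunc.
  by exists c1.
- move=> c c1 [cg _] _ E; split=> [[b [y cE]]|[b [y cE]]].
    have [|w wE] := (kmap_exact (c1 - kdiff y)).1.
      by rewrite raddfB /= -E cE raddfD /= kdiff_kdiff add0r kdiff_kmap subrr.
    by exists y, w; rewrite -wE addrC subrK.
  have [| |d dE] := @kdiff_exact _ _ _ (c - kmap (aug_diff q) b).
  + rewrite raddfB /= E cE raddfD /= kdiff_kmap.
    have -> : kmap (aug_diff q) (kmap (aug_diff q.+1) y) = 0.
      by apply/kmap_exact; exists y.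
    by rewrite addr0 subrr.
  (* A chain of Koszul degree [p.+1] has no component at [set0]. *)
  + move=> k; rewrite kchainBE mcoeffB kmap_mcoeff0 subr0; apply/eqP.
    by rewrite mcoeff_eq0; apply/negP => /cg[]; rewrite cards0.
  by exists d, b; rewrite -dE subrK.
Qed.

Definition kdelta q (k : 'I_(aug_rank q)) : kchain (aug_rank q) :=
  [ffun S : {set 'I_n} => if S == set0 then delta_mx 0 k else 0].

Lemma kdelta_sum0 q (J : {set 'I_(aug_rank q)}) (x : 'I_(aug_rank q) -> K) l :
  ((\sum_(k in J) io (x k) *: kdelta k) set0 0 l)@_0%MM = if l \in J then x l else 0.
Proof.
rewrite sum_ffunE summxE raddf_sum /=.
rewrite (eq_bigr (fun k => x k * (l == k)%:R)) => [|k _]; last first.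
  by rewrite !ffunE eqxx !mxE eqxx mcoeffCM; case: eqP; rewrite ?mcoeff1 ?mcoeff0 ?eqxx.
case: ifP => lJ.
  rewrite (bigD1 l) //= eqxx mulr1 big1 ?addr0 // => k /andP[_ ne_kl].
  by rewrite eq_sym (negbTE ne_kl) mulr0.
rewrite big1 // => k kJ; case: eqP => [E|_]; rewrite ?mulr0 //.
by rewrite E kJ in lJ.
Qed.

Lemma kdiff_mcoeff0 m (b : kchain m) l : (kdiff b set0 0 l)@_0%MM = 0.
Proof.
rewrite kdiffE raddf_sum big1 //= => i _.
by rewrite -mulrA mcoeffCM mcoeffXM mnm0E mulr0.
Qed.

(** In Koszul degree 0 the constant terms at [set0] are coordinates: by minimality they vanish on
    boundaries, and a homogeneous chain with all of them zero bounds. *)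
Lemma tor0_basis q j : qbasis io (@tor_cycle q 0 j) (@tor_boundary q)
  [set k | aug_deg k == j] (@kdelta q).
Proof.
set J := [set k | _].
have Z0 (c : kchain (aug_rank q)) : bidegree 0 j c -> kdiff c = 0.
  move=> cg; apply: kchainP => S k; rewrite kdiffE ffunE mxE /koszul big1 // => i iS.
  suff -> : c (i |: S) 0 k = 0 by rewrite mulr0.
  apply/mpolyP => m; rewrite mcoeff0; apply/eqP; rewrite mcoeff_eq0.
  by apply/negP => /cg[]; rewrite cardsU1 iS.
have dZ k : k \in J -> tor_cycle 0 j (kdelta k).
  rewrite inE => /eqP dk.
  have dg : bidegree 0 j (kdelta k).
    move=> S l m; rewrite mcoeff_msupp ffunE.
    case: (S =P set0) => [->|_]; last by rewrite mxE mcoeff0 eqxx.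
    rewrite mxE eqxx cards0; case: (eqVneq l k) => [->|_]; last by rewrite mcoeff0 eqxx.
    rewrite mcoeff1; case: (m =P 0%MM) => [->|_]; last by rewrite eqxx.
    by rewrite mdeg0.
  by split=> //; exists 0; rewrite Z0 // raddf0.
split=> //.
  move=> z [zg zZ]; pose x k := (z set0 0 k)@_0%MM; exists x.
  set w := z - _.
  have [wg _] : tor_cycle 0 j w.
    apply: subspB (subsp_tor_cycle q 0 j) _ _ => //.
    by apply: subsp_sum (subsp_tor_cycle q 0 j) _.
  have [k|b bE] := kdiff_exact (Z0 _ wg); last first.
    by exists b, 0; rewrite raddf0 addr0.
  rewrite /w kchainBE mcoeffB kdelta_sum0; case: ifP => kJ; first by rewrite subrr.
  rewrite subr0; apply/eqP; rewrite mcoeff_eq0; apply/negP => /zg[_].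
  by rewrite mdeg0 cards0 !add0n => E; rewrite inE E eqxx in kJ.
move=> x [b [y E]] k kJ.
have := kdelta_sum0 J x k; rewrite E kJ kchainDE mcoeffD kdiff_mcoeff0.
by rewrite kmap_mcoeff0 addr0.
Qed.

(** F_i has index i + 1 in the augmented sequence, hence i + 1 shifts. *)
Lemma tor_basis i j : exists c, qbasis io (@tor_cycle 0 i.+1 j) (@tor_boundary 0)
  [set k | @res_deg _ _ F i k == j] c.
Proof.
have H p q (T : finType) (J : {set T}) :
    (exists c, qbasis io (@tor_cycle (p + q) 0 j) (@tor_boundary (p + q)) J c) ->
    exists c, qbasis io (@tor_cycle q p j) (@tor_boundary q) J c.
  elim: p q => [|p IHp] q // exJ; rewrite addSnnS in exJ.
  by have [c qc] := IHp _ exJ; apply: tor_shift qc.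
apply: H; rewrite addn0; exists (@kdelta i.+1); exact: (@tor0_basis i.+1).
Qed.

Lemma betti_tor i j (T : finType) (J : {set T}) c :
  qbasis io (@tor_cycle 0 i.+1 j) (@tor_boundary 0) J c -> betti F i j = #|J|.
Proof.
have [c' qc'] := tor_basis i j; exact: qbasis_card (subsp_tor_boundary 0) qc'.
Qed.

Lemma betti_eq0 i j :
  betti F i j = 0%N <-> forall c, tor_cycle i.+1 j c -> @tor_boundary 0 c.
Proof.
split=> [b0 c cZ|ZB].
  have [c' [_ c'S _]] := tor_basis i j; have [x] := c'S c cZ.
  move/eqP: b0; rewrite cards_eq0 => /eqP J0.
  by rewrite big_pred0 ?subr0 // => k; rewrite J0 inE.
have q0 : qbasis io (@tor_cycle 0 i.+1 j) (@tor_boundary 0) (set0 : {set 'I_0}) (fun=> 0).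
  split=> [k|z /ZB Bz|x _ k]; rewrite ?inE //.
  by exists (fun=> 0); rewrite big_set0 subr0.
by rewrite (betti_tor q0) cards0.
Qed.

End BettiNumbers.

(** * Induced cycles and quadratic monomial ideals *)

Section InducedCycles.
Variables (T : finType) (e : rel T).
Hypothesis e_sym : ssrbool.symmetric e.
Hypothesis e_irr : irreflexive e.

Lemma cycle_edges_cover (v : seq T) : cover (cycle_edges v) = [set x in v].
Proof.
apply/setP => x; rewrite inE; apply/bigcupP/idP => [[E /imsetP[y yv ->]]|xv].
  by rewrite !inE => /pred2P[] -> //; rewrite mem_next.
exists [set x; next v x]; last exact: set21.
by apply/imsetP; exists x.
Qed.

Definition cnext (m i : nat) : nat := if i.+1 == m then 0%N else i.+1.

Lemma cadj_cnext m i j : (i < m)%N -> (j < m)%N ->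
  cadj m i j = (j == cnext m i) || (i == cnext m j).
Proof. rewrite /cadj /cnext; case: (i.+1 =P m); case: (j.+1 =P m); lia. Qed.

Lemma next_nth_cnext (x0 : T) (v : seq T) i : uniq v -> (i < size v)%N ->
  next v (nth x0 v i) = nth x0 v (cnext (size v) i).
Proof.
case: v => // y v Uv iv; rewrite next_nth mem_nth // index_uniq //.
rewrite /cnext eqSS /=; case: eqP => [->|ne].
  by rewrite nth_default.
by apply: set_nth_default; rewrite ltn_neqAle -ltnS iv andbT; apply/eqP.
Qed.

Lemma induced_cycle_edges t C : C \in induced_cycles e t ->
  forall E, E \in C <->
    exists x y, [/\ x \in cover C, y \in cover C, e x y & E = [set x; y]].
Proof.
rewrite inE => /andP[/andP[_ /existsP[v /and3P[Uv cv /eqP EC]]] /forall_inP indC] E.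
split=> [|[x [y [xC yC exy ->]]]]; last first.
  by have /forall_inP/(_ y yC)/implyP/(_ exy) := indC x xC.
rewrite EC cycle_edges_cover => /imsetP[x xv ->]; exists x, (next v x).
by rewrite !inE mem_next xv; split=> //; apply: next_cycle cv xv.
Qed.

(** The edges of an induced cycle are all edges among its vertices. Counting cycles as subgraphs is
    thus counting squarefree multidegrees. *)
Lemma induced_cycle_cover_inj t : {in induced_cycles e t &, injective cover}.
Proof.
move=> C C' iC iC' E; apply/setP => X.
apply/idP/idP.
  by move/(induced_cycle_edges iC); rewrite E => /(induced_cycle_edges iC').
by move/(induced_cycle_edges iC'); rewrite -E => /(induced_cycle_edges iC).
Qed.

Lemma icycle_induced m (s : nat -> T) (W : {set T}) : (3 <= m)%N ->
  icycle e m s -> (forall x, x \in W <-> exists2 i, (i < m)%N & x = s i) ->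
  exists2 C, C \in induced_cycles e m & cover C = W.
Proof.
move=> m3 [s_inj se] WE.
have sz : size (mkseq s m) == m by rewrite size_mkseq.
pose v : m.-tuple T := Tuple sz.
have vE : v = mkseq s m :> seq T by [].
have x0 := s 0%N.
have nthv i : (i < m)%N -> nth x0 v i = s i by move=> im; rewrite vE nth_mkseq.
have Uv : uniq v.
  rewrite vE map_inj_in_uniq ?iota_uniq // => i j.
  by rewrite !mem_iota !add0n => im jm; apply: s_inj.
have memv x : x \in v <-> exists2 i, (i < m)%N & x = s i.
  split=> [/mapP[i]|[i im ->]]; first by rewrite mem_iota; exists i.
  by apply: map_f; rewrite mem_iota.
have cnext_lt i : (i < m)%N -> (cnext m i < m)%N by rewrite /cnext; case: eqP; lia.
have nextv i : (i < m)%N -> next v (s i) = s (cnext m i).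
  move=> im; rewrite -(nthv i im) next_nth_cnext ?size_tuple // nthv //.
  exact: cnext_lt.
have covW : cover (cycle_edges v) = W.
  rewrite cycle_edges_cover; apply/setP => x; rewrite inE.
  by apply/idP/idP => [/memv/WE|/WE/memv].
exists (cycle_edges v) => //; rewrite inE; apply/andP; split.
  rewrite /is_cycle m3; apply/existsP; exists v; rewrite Uv eqxx andbT /=.
  apply: cycle_from_next => // x /memv[i im ->]; rewrite nextv // se ?cnext_lt //.
  by rewrite cadj_cnext ?cnext_lt // eqxx.
apply/forall_inP => x; rewrite covW => /WE[i im ->].
apply/forall_inP => y /WE[j jm ->]; apply/implyP; rewrite se // cadj_cnext //.
case/orP => /eqP ->; apply/imsetP.
- by exists (s i); rewrite ?nextv //; apply/memv; exists i.
- by exists (s j); rewrite ?nextv //; [apply/memv; exists j | rewrite setUC].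
Qed.

Lemma induced_icycle t C : C \in induced_cycles e t ->
  exists2 s, icycle e t s &
    forall x, x \in cover C <-> exists2 i, (i < t)%N & x = s i.
Proof.
move=> iC; have edgeC := induced_cycle_edges iC.
move: (iC); rewrite inE => /andP[/andP[t3 /existsP[v /and3P[Uv cv /eqP EC]]] _].
have /hasP[x0 _ _] : has predT v by rewrite has_predT size_tuple; lia.
pose s i := nth x0 v i.
have sz : size v = t by rewrite size_tuple.
have idx x : x \in v -> exists2 k, (k < t)%N & x = s k.
  move=> xv; exists (index x v); last by rewrite /s nth_index.
  by move: xv; rewrite -index_mem sz.
have sv i : (i < t)%N -> s i \in v by move=> it; rewrite mem_nth ?sz.
have covE : cover C = [set x in v] by rewrite EC cycle_edges_cover.
have s_inj i j : (i < t)%N -> (j < t)%N -> s i = s j -> i = j.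
  by move=> it jt /eqP; rewrite nth_uniq ?sz // => /eqP.
have cnext_lt i : (i < t)%N -> (cnext t i < t)%N by rewrite /cnext; case: eqP; lia.
have nexts i : (i < t)%N -> next v (s i) = s (cnext t i).
  by move=> it; rewrite /s next_nth_cnext ?sz.
exists s.
  split=> // i j it jt; rewrite cadj_cnext //; apply/idP/idP => [eij|].
    have : [set s i; s j] \in C.
      by apply/edgeC; exists (s i), (s j); rewrite covE !inE !sv.
    rewrite EC => /imsetP[x xv E].
    have [k kt xk] := idx x xv.
    have ne_ij : i <> j by move=> Eij; rewrite Eij e_irr in eij.
    rewrite xk nexts // in E; have kt' := cnext_lt k kt.
    have := set21 (s i) (s j); have := set22 (s i) (s j); rewrite E !inE.
    case/pred2P => /s_inj jE /pred2P[] /s_inj iE; rewrite iE // jE // ?eqxx ?orbT //.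
      by case: ne_ij; rewrite iE // jE.
    by case: ne_ij; rewrite iE // jE.
  case/orP => /eqP ->; rewrite -nexts //; last rewrite e_sym.
    by apply: next_cycle cv _; apply: sv.
  by apply: next_cycle cv _; apply: sv.
by move=> x; rewrite covE inE; split=> [/idx|[i it ->]]; last exact: sv.
Qed.

End InducedCycles.

Section MonomialIdeals.
Variables (K : fieldType) (n : nat) (I : {pred {mpoly K[n]}}).
Local Notation R := {mpoly K[n]}.

Lemma mem_monomial_ideal M (p : R) : generated_by_monomials I M ->
  p \in I <-> forall m, m \in msupp p -> exists2 m0, M m0 & (m0 <= m)%MM.
Proof.
move=> genI; split=> [/genI[s [sM ->]] m|H].
  move/msupp_sum_le => /flattenP[l /mapP[cg cgs ->]].
  rewrite mem_filter /= in cgs; have [m0 Mm0 ->] := sM cg cgs.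
  rewrite (perm_mem (msuppMX _ _)) => /mapP[m' _ ->].
  by exists m0 => //; apply: lem_addr.
apply/genI; rewrite (mpolyE p); elim: (msupp p) H => [|m l IHl] H.
  by exists [::]; rewrite !big_nil; split.
have [|s [sM sE]] := IHl; first by move=> m' m'l; apply: H; rewrite inE m'l orbT.
have [m0 Mm0 le_m0m] := H m (mem_head _ _).
exists ((p@_m *: 'X_[m - m0], 'X_[m0]) :: s); split.
  by move=> cg; rewrite inE => /predU1P[->|/sM//] /=; exists m0.
by rewrite !big_cons sE /= -scalerAl -mpolyXD submK.
Qed.

Lemma monomial_idealE M (p : R) : generated_by_monomials I M ->
  p \in I <-> forall m, m \in msupp p -> 'X_[m] \in I.
Proof.
move=> genI; split=> [/(mem_monomial_ideal _ genI) H m /H [m0 Mm0 le_m]|H].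
  by apply/(mem_monomial_ideal _ genI) => m'; rewrite msuppX inE => /eqP->; exists m0.
apply/(mem_monomial_ideal _ genI) => m /H /(mem_monomial_ideal _ genI); apply.
by rewrite msuppX inE.
Qed.

Lemma mdeg2P (m : 'X_{1..n}) : mdeg m = 2%N -> exists i k, m = (U_(i) + U_(k))%MM.
Proof.
move=> m2; have : m != 0%MM by apply/eqP => E; rewrite E mdeg0 in m2.
have [i mi _|m0] := pickP (fun i => (0 < m i)%N); last first.
  by case/eqP; apply/mnmP => i; rewrite mnm0E; have := m0 i; lia.
have le_im : (U_(i) <= m)%MM by rewrite lep1mP -lt0n.
have : mdeg (m - U_(i)) == 1%N.
  by move: m2; rewrite -{1}(submK le_im) mdegD mdeg1; lia.
by case/mdeg1P => k /eqP E; exists i, k; rewrite -(submK le_im) E addmC.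
Qed.

Lemma mem_quadratic_ideal (m : 'X_{1..n}) : generated_by_quadratic_monomials I ->
  'X_[m] \in I <-> exists i k, ideal_graph I i k /\ (U_(i) + U_(k) <= m)%MM.
Proof.
move=> [M M2 genI]; split=> [/(mem_monomial_ideal _ genI)/(_ m)|[i [k [ik le_m]]]].
  rewrite msuppX inE eqxx => /(_ isT)[m0 Mm0 le_m].
  have [i [k E]] := mdeg2P (M2 _ Mm0); exists i, k; rewrite -E; split=> //.
  rewrite /ideal_graph /in_mem /= -mpolyXD -E; apply/(mem_monomial_ideal _ genI) => m'.
  by rewrite msuppX inE => /eqP->; exists m0 => //; apply: lepm_refl.
move: ik; rewrite /ideal_graph -mpolyXD.
move=> /(mem_monomial_ideal _ genI)/(_ (U_(i) + U_(k))%MM).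
rewrite msuppX inE eqxx => /(_ isT)[m0 Mm0 le_m0].
apply/(mem_monomial_ideal _ genI) => m'; rewrite msuppX inE => /eqP->.
by exists m0 => //; apply: lepm_trans le_m.
Qed.

Hypothesis I_quad : generated_by_quadratic_monomials I.
Local Notation e := (compl_graph (ideal_graph I)).
Local Notation loop i := (ideal_graph I i i).

Lemma ideal_graph_sym : ssrbool.symmetric (ideal_graph I).
Proof. by move=> i k; rewrite /ideal_graph mulrC. Qed.

Lemma compl_ideal_graph_sym : ssrbool.symmetric e.
Proof. by move=> i k; rewrite /compl_graph eq_sym ideal_graph_sym. Qed.

Lemma compl_ideal_graph_irr : irreflexive e.
Proof. by move=> i; rewrite /compl_graph eqxx. Qed.

Lemma notin_quadratic_idealP (m : 'X_{1..n}) :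
  reflect ((forall i k, i != k -> (0 < m i)%N -> (0 < m k)%N -> e i k) /\
           (forall i, (1 < m i)%N -> ~~ loop i))
          ('X_[m] \notin I).
Proof.
apply: (iffP idP) => [mI|[me ml]].
  split=> [i k ne_ik mi mk|i mi].
    rewrite /compl_graph ne_ik; apply: contra mI => ik.
    apply/(mem_quadratic_ideal _ I_quad); exists i, k; split=> //; apply/mnm_lepP => l.
    rewrite mnmDE !mnm1E; case: (eqVneq i l) => [<-|_].
      by rewrite 1?eq_sym ?(negbTE ne_ik).
    by case: (eqVneq k l) => [<-|_].
  apply: contra mI => ii; apply/(mem_quadratic_ideal _ I_quad); exists i, i; split=> //.
  by apply/mnm_lepP => l; rewrite mnmDE !mnm1E; case: (eqVneq i l) => [<-|_].
apply/negP => /(mem_quadratic_ideal _ I_quad)[i [k [ik /mnm_lepP le_m]]].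
have := le_m i; have := le_m k; rewrite !mnmDE !mnm1E !eqxx.
case: (eqVneq i k) => [Eik|ne_ik].
  by rewrite -Eik => mi _; case/negP: (ml i mi); rewrite {2}Eik.
move=> mk mi.
by have := me i k ne_ik mi mk; rewrite /compl_graph ik andbF.
Qed.

(** The squarefree generating set is not assumed quadratic. A member dividing x_i^2 is supported at
    [i] with exponent at most 1, yet it lies in [I] and so is divisible by a quadric. *)
Lemma squarefree_no_loop : squarefree_monomial_ideal I -> forall i, ~~ loop i.
Proof.
move=> [M M1 genI] i; apply/negP; rewrite /ideal_graph -mpolyXD.
move=> /(mem_monomial_ideal _ genI)/(_ (U_(i) + U_(i))%MM).
rewrite msuppX inE eqxx => /(_ isT)[m0 Mm0 /mnm_lepP le_m0].
have : 'X_[m0] \in I.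
  apply/(mem_monomial_ideal _ genI) => m'; rewrite msuppX inE => /eqP->.
  by exists m0 => //; apply: lepm_refl.
case/(mem_quadratic_ideal _ I_quad) => k [l [_ /mnm_lepP le_kl]].
have le1 := M1 _ Mm0.
have eqi j : (0 < m0 j)%N -> j = i.
  by have := le_m0 j; rewrite mnmDE !mnm1E; case: (eqVneq i j) => // _; lia.
have ki : k = i by apply: eqi; have := le_kl k; rewrite mnmDE !mnm1E eqxx; lia.
have li : l = i by apply: eqi; have := le_kl l; rewrite mnmDE !mnm1E eqxx; lia.
by have := le_kl i; have := le1 i; rewrite ki li mnmDE mnm1E eqxx; lia.
Qed.

End MonomialIdeals.

(** * Multigraded strands *)

Section Strands.
Variables (K : fieldType) (n : nat) (I : {pred {mpoly K[n]}}).
Variable F : free_sequence K n.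
Hypothesis I_quad : generated_by_quadratic_monomials I.
Hypothesis F_res : minimal_graded_free_resolution I F.
Local Notation R := {mpoly K[n]}.
Local Notation e := (compl_graph (ideal_graph I)).
Local Notation loop i := (ideal_graph I i i).
Local Notation kchain m := {ffun {set 'I_n} -> 'rV[R]_m}.
Local Notation io := (@mpolyC n K).
Implicit Types (S X W : {set 'I_n}) (a m : 'X_{1..n}) (f g : {set 'I_n} -> K).

Lemma aug_graded q k l :
  homog_diff (@aug_deg _ _ F _ k) (aug_deg l) (aug_diff F q k l).
Proof.
have [[Fa Fd] _ _] := F_res; case: q k l => [|q] k l; last exact: Fd.
by rewrite (ord1 l); apply: Fa.
Qed.

Lemma aug_exact q (v : 'rV_(aug_rank F q.+1)) :
  v *m aug_diff F q = 0 <-> exists w, v = w *m aug_diff F q.+1.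
Proof. by have [_ [_ F0 FS] _] := F_res; case: q v. Qed.

Lemma ideal_mcoeff0 (p : R) : p \in I -> p@_0%MM = 0.
Proof.
have [M M2 genI] := I_quad; move=> /(mem_monomial_ideal _ genI) H; apply/eqP.
rewrite mcoeff_eq0; apply/negP => /H[m0 /M2 m02 /mnm_lepP le0].
have E : m0 = 0%MM by apply/mnmP => i; have := le0 i; rewrite mnm0E; lia.
by rewrite E mdeg0 in m02.
Qed.

(** [minimal] covers the differentials only; the entries of the augmentation lie in [I], which has
    no constant terms. *)
Lemma aug_minimal q k l : (aug_diff F q k l)@_0%MM = 0.
Proof.
have [_ [FI _ _] Fm] := F_res; case: q k l => [|q] k l; last exact: Fm.
rewrite (ord1 l); apply: ideal_mcoeff0; apply/FI; exists (delta_mx 0 k).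
by rewrite -rowE mxE.
Qed.

Lemma kmap_augP (u : kchain 1) :
  (exists y, u = kmap (aug_diff F 0) y) <-> forall S, u S 0 0 \in I.
Proof.
have [_ [FI _ _] _] := F_res; split=> [[y ->] S|uI].
  by rewrite ffunE; apply/FI; exists (y S).
have H S : exists v : 'rV_(res_rank F 0), (v *m res_aug F) 0 0 = u S 0 0.
  by apply: (FI _).1; apply: uI.
have [y yE] := fin_all_exists H; exists (finfun y).
by apply: kchainP => S k; rewrite !ffunE (ord1 k) yE.
Qed.

(* x^(a - S) e_S is a basis element of the strand of R / I. *)
Definition in_quot a S : bool :=
  (S \subset mnm_supp a) && ('X_[a - mnm_set S] \notin I).

(** Chains over R / I are represented by lifts to R, so [f] may be nonzero off [in_quot], where
    equations are not tested. *)
Definition strand_cycle a p f : Prop :=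
  (forall S, f S != 0 -> (S \subset mnm_supp a) /\ #|S| = p) /\
  (forall S, in_quot a S -> bdry f S = 0).

Definition strand_boundary a f : Prop :=
  exists g, (forall S, ~~ (S \subset mnm_supp a) -> g S = 0) /\
            (forall S, in_quot a S -> f S = bdry g S).

Definition scal (c : kchain 1) S : R := c S 0 0.

Lemma ideal_strand (u : kchain 1) : (forall S, u S 0 0 \in I) <->
  forall a S, in_quot a S -> strand a (scal u) S = 0.
Proof.
have [M M2 genI] := I_quad; split=> [uI a S /andP[Sa aI]|H S].
  rewrite /strand Sa; apply/eqP; rewrite mcoeff_eq0; apply: contra aI => H.
  by have /(monomial_idealE _ genI) := uI S; apply.
apply/(monomial_idealE _ genI) => m; apply: contraLR => mI.
rewrite -mcoeff_eq0 -[_@_m](strandD_set m (scal u) S) H //.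
by rewrite /in_quot mnm_supp_addr_set addmK.
Qed.

Lemma strandD a (c c' : kchain 1) S :
  strand a (scal (c + c')) S = strand a (scal c) S + strand a (scal c') S.
Proof. by rewrite /strand /scal kchainDE; case: ifP; rewrite ?mcoeffD ?addr0. Qed.

Lemma strandB a (c c' : kchain 1) S :
  strand a (scal (c - c')) S = strand a (scal c) S - strand a (scal c') S.
Proof. by rewrite /strand /scal kchainBE; case: ifP; rewrite ?mcoeffB ?subr0. Qed.

Lemma strandZ a x (c : kchain 1) S :
  strand a (scal (io x *: c)) S = x * strand a (scal c) S.
Proof.
by rewrite /strand /scal ffunE mxE; case: ifP; rewrite ?mcoeffCM ?mulr0.
Qed.

Lemma strand_sum a (T : finType) (J : {set T}) (c : T -> kchain 1) S :
  strand a (scal (\sum_(k in J) c k)) S = \sum_(k in J) strand a (scal (c k)) S.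
Proof.
elim/big_rec2: _ => [|k y1 y2 _ <-]; last by rewrite strandD.
by rewrite /strand /scal ffunE mxE mcoeff0 if_same.
Qed.

Lemma strand_kdiff a (c : kchain 1) S :
  strand a (scal (kdiff c)) S = bdry (strand a (scal c)) S.
Proof. by rewrite -strand_koszul /strand /scal kdiffE. Qed.

Lemma tor_cycle_strand p j (c : kchain 1) : @tor_cycle _ _ F 0 p j c ->
  forall a, strand_cycle a p (strand a (scal c)) /\
            (mdeg a != j -> forall S, strand a (scal c) S = 0).
Proof.
move=> [cg cy] a.
have supp S : strand a (scal c) S != 0 ->
    [/\ S \subset mnm_supp a, #|S| = p & mdeg a = j].
  rewrite /strand; case: ifP => Sa; last by rewrite eqxx.
  rewrite -mcoeff_msupp => /cg [cS mj]; split=> //.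
  by move: mj; rewrite /= addn0 -mdeg_mnm_set -mdegD submK // mnm_set_le.
split; last first.
  by move=> aj S; apply/eqP; apply: contraNT aj => /supp[_ _ ->].
split=> [S /supp[]//|S SL].
by rewrite -strand_kdiff; apply: (ideal_strand _).1 SL; apply/kmap_augP.
Qed.

Lemma tor_boundary_strand (c : kchain 1) :
  @tor_boundary _ _ F 0 c <-> forall a, strand_boundary a (strand a (scal c)).
Proof.
split=> [[b [y cE]] a|H].
  exists (strand a (scal b)); split=> [S|S SL]; first exact: strand_supp.
  rewrite cE strandD strand_kdiff [X in _ + X](_ : _ = 0) ?addr0 //.
  by apply: (ideal_strand _).1 SL; apply/kmap_augP; exists y.
have [|b bE] := @koszul_assemble _ _ (fun m => 'X_[m] \in I) (scal c).
  move=> a; have [g [gU gE]] := H a; exists g; split=> // S Sa SI; apply: gE.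
  by rewrite /in_quot Sa.
pose b' : kchain 1 := [ffun S : {set 'I_n} => const_mx (b S)].
have [|y yE] := (kmap_augP (c - kdiff b')).2.
  have [M M2 genI] := I_quad; move=> S; apply/(monomial_idealE _ genI) => m.
  apply: contraLR => mI; rewrite -mcoeff_eq0 kchainBE mcoeffB bE // kdiffE.
  rewrite subr_eq0; apply/eqP; congr (_@_m).
  by apply: eq_bigr => i _; rewrite ffunE mxE.
by exists b', y; rewrite -yE addrC subrK.
Qed.

Definition strand_chain a f : kchain 1 :=
  [ffun S : {set 'I_n} =>
     const_mx (if S \subset mnm_supp a then f S *: 'X_[a - mnm_set S] else 0)].

Lemma strand_strand_chain a a' p f S : strand_cycle a p f ->
  strand a' (scal (strand_chain a f)) S = if a' == a then f S else 0.
Proof.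
move=> [fS _]; rewrite /strand /scal ffunE mxE.
have [Sa|Sa] := boolP (S \subset mnm_supp a); last first.
  rewrite mcoeff0 if_same; have [/fS[]|/negbNE/eqP->] := boolP (f S != 0).
    by rewrite (negbTE Sa).
  by rewrite if_same.
rewrite mcoeffZ mcoeffX; case: (eqVneq a' a) => [->|ne_a]; first by rewrite Sa eqxx mulr1.
case: ifP => // Sa'; case: eqP => [E|_]; rewrite ?mulr0 //; case/eqP: ne_a.
by rewrite -(@submK _ (mnm_set S) a') ?mnm_set_le // -E submK // mnm_set_le.
Qed.

Lemma tor_cycle_strand_chain a p f : strand_cycle a p f ->
  @tor_cycle _ _ F 0 p (mdeg a) (strand_chain a f).
Proof.
move=> fZ; have [fS fB] := fZ; split.
  move=> S k m; rewrite (ord1 k) mcoeff_msupp ffunE mxE.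
  case: ifP => Sa; last by rewrite mcoeff0 eqxx.
  rewrite mcoeffZ mcoeffX.
  case: ((a - mnm_set S)%MM =P m) => [<-|_]; last by rewrite mulr0 eqxx.
  rewrite mulr1 => /fS[_ <-]; split=> //.
  by rewrite addn0 -mdeg_mnm_set -mdegD submK // mnm_set_le.
apply/kmap_augP/ideal_strand => a' S SL; rewrite strand_kdiff.
rewrite /bdry; under eq_bigr => i _ do rewrite (strand_strand_chain _ _ fZ).
move: SL; case: eqVneq => [->|_ _]; first exact: fB.
by rewrite big1 // => i _; rewrite mulr0.
Qed.

Lemma strand_boundary0 a f : (forall S, in_quot a S -> f S = 0) -> strand_boundary a f.
Proof.
move=> f0; exists (fun=> 0); split=> // S /f0->.
by rewrite /bdry big1 // => i _; rewrite mulr0.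
Qed.

Lemma strand_boundary_ext a f f' : f =1 f' -> strand_boundary a f -> strand_boundary a f'.
Proof. by move=> E [g [gU gE]]; exists g; split=> // S SL; rewrite -E gE. Qed.

Lemma betti_strand_eq0 i j :
  (forall a f, mdeg a = j -> strand_cycle a i.+1 f -> strand_boundary a f) ->
  betti F i j = 0%N.
Proof.
move=> H; apply/(betti_eq0 aug_graded aug_exact aug_minimal) => c cZ.
apply/tor_boundary_strand => a; have [fZ f0] := tor_cycle_strand cZ a.
have [aj|aj] := eqVneq (mdeg a) j; first exact: H fZ.
by apply: strand_boundary0 => S _; apply: f0.
Qed.

Lemma betti_strand_neq0 i a f : strand_cycle a i.+1 f -> ~ strand_boundary a f ->
  betti F i (mdeg a) <> 0%N.
Proof.
move=> fZ fB /(betti_eq0 aug_graded aug_exact aug_minimal) H; apply: fB.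
have /tor_boundary_strand/(_ a) := H _ (tor_cycle_strand_chain fZ).
by apply: strand_boundary_ext => S; rewrite (strand_strand_chain _ _ fZ) eqxx.
Qed.

(** Each strand [aa k] contributes one dimension and the other strands of degree [j] none;
    injectivity of [aa] keeps the classes in separate strands. *)
Lemma betti_strand i j (T : finType) (J : {set T}) (aa : T -> 'X_{1..n})
    (ff : T -> {set 'I_n} -> K) :
  {in J &, injective aa} ->
  (forall k, k \in J -> mdeg (aa k) = j) ->
  (forall k, k \in J -> strand_cycle (aa k) i.+1 (ff k)) ->
  (forall k x, k \in J -> strand_boundary (aa k) (fun S => x * ff k S) -> x = 0) ->
  (forall k f, k \in J -> strand_cycle (aa k) i.+1 f ->
     exists x, strand_boundary (aa k) (fun S => f S - x * ff k S)) ->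
  (forall a f, mdeg a = j -> (forall k, k \in J -> a != aa k) ->
     strand_cycle a i.+1 f -> strand_boundary a f) ->
  betti F i j = #|J|.
Proof.
move=> aa_inj aaj ffZ ffI ffS H.
have strandJ (x : T -> K) a S :
    strand a (scal (\sum_(k in J) io (x k) *: strand_chain (aa k) (ff k))) S =
    \sum_(k in J) x k * (if a == aa k then ff k S else 0).
  rewrite strand_sum; apply: eq_bigr => k kJ.
  by rewrite strandZ (strand_strand_chain _ _ (ffZ k kJ)).
have strandJk (x : T -> K) k S : k \in J ->
    strand (aa k) (scal (\sum_(k in J) io (x k) *: strand_chain (aa k) (ff k))) S =
    x k * ff k S.
  move=> kJ; rewrite strandJ (bigD1 k) //= eqxx big1 ?addr0 // => l /andP[lJ ne_lk].
  case: eqP => [/aa_inj E|_]; rewrite ?mulr0 //.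
  by rewrite E ?eqxx in ne_lk.
apply: (betti_tor aug_graded aug_exact aug_minimal
          (c := fun k => strand_chain (aa k) (ff k))); split.
- by move=> k kJ; rewrite -(aaj k kJ); apply: tor_cycle_strand_chain; apply: ffZ.
- move=> z zZ.
  have Hx k : exists x : K, k \in J ->
      strand_boundary (aa k) (fun S => strand (aa k) (scal z) S - x * ff k S).
    case: (boolP (k \in J)) => kJ; last by exists 0.
    have [fZ _] := tor_cycle_strand zZ (aa k).
    by have [x xB] := ffS k _ kJ fZ; exists x.
  have [x xE] := fin_all_exists Hx.
  exists x; apply/tor_boundary_strand => a.
  have [/exists_inP[k kJ /eqP ->]|aJ] := boolP [exists k in J, a == aa k].
    apply: strand_boundary_ext (xE k kJ) => S.
    by rewrite strandB strandJk.
  have [fZ f0] := tor_cycle_strand zZ a.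
  apply: (@strand_boundary_ext _ (strand a (scal z))) => [S|].
    rewrite strandB strandJ big1 ?subr0 // => k kJ; case: eqP => [E|_]; rewrite ?mulr0 //.
    by case/negP: aJ; apply/exists_inP; exists k => //; apply/eqP.
  have [aj|aj] := eqVneq (mdeg a) j; last by apply: strand_boundary0 => S _; apply: f0.
  apply: (H _ _ aj _ fZ) => k kJ; apply: contra aJ => aE.
  by apply/exists_inP; exists k.
- move=> x /tor_boundary_strand xB k kJ; apply: (ffI k _ kJ).
  by apply: strand_boundary_ext (xB (aa k)) => S; apply: strandJk.
Qed.

End Strands.

(** * Strands with an exponent at least 2 *)

Section StrandHomology.
Variables (K : fieldType) (n : nat) (I : {pred {mpoly K[n]}}).
Hypothesis I_quad : generated_by_quadratic_monomials I.
Local Notation R := {mpoly K[n]}.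
Local Notation e := (compl_graph (ideal_graph I)).
Local Notation loop i := (ideal_graph I i i).
Implicit Types (S X W : {set 'I_n}) (a m : 'X_{1..n}) (f g : {set 'I_n} -> K).

Let e_sym := compl_ideal_graph_sym I.
Let e_irr := compl_ideal_graph_irr I.

Lemma in_quotP a S :
  reflect [/\ S \subset mnm_supp a,
     forall i k, i != k -> (i \in S < a i)%N -> (k \in S < a k)%N -> e i k
     & forall i, ((i \in S).+1 < a i)%N -> ~~ loop i]
    (in_quot I a S).
Proof.
apply: (iffP andP) => [[Sa /(notin_quadratic_idealP I_quad)[He Hl]]|[Sa He Hl]];
  split=> //.
- by move=> i k ne_ik ai ak; apply: He => //; rewrite mnmBE mnm_setE subn_gt0.
- by move=> i ai; apply: Hl; rewrite mnmBE mnm_setE ltn_subRL addn1.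
apply/(notin_quadratic_idealP I_quad); split.
- by move=> i k ne_ik; rewrite !mnmBE !mnm_setE !subn_gt0; apply: He.
- by move=> i; rewrite mnmBE mnm_setE ltn_subRL addn1; apply: Hl.
Qed.

Lemma in_quot_set W S :
  in_quot I (mnm_set W) S = (S \subset W) && clique e (W :\: S).
Proof.
apply/in_quotP/andP => [[SW He _]|[SW /cliqueP clW]].
  rewrite mnm_supp_set in SW; split=> //; apply/cliqueP => i k.
  rewrite !inE => /andP[iS iW] /andP[kS kW] ne_ik.
  by apply: He; rewrite // mnm_setE ?(negbTE iS) ?(negbTE kS) ?iW ?kW.
rewrite mnm_supp_set; split=> // [i k ne_ik|i]; rewrite !mnm_setE; last first.
  by case: (i \in S); case: (i \in W).
move=> Hi Hk; apply: clW => //; rewrite inE.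
  by move: Hi; case: (i \in S); case: (i \in W).
by move: Hk; case: (k \in S); case: (k \in W).
Qed.

(* If b is a loop with a_b >= 2, then every S in the strand contains b, and the
   complement of S is a clique inside the neighbourhood of b. *)
Lemma strand_acyclic_not_squarefree a p f :
  (forall b b', loop b -> loop b' -> ~~ e b b') ->
  (forall b u v, loop b -> e b u -> e b v -> u != v -> e u v) ->
  strand_cycle I a p f -> (p + 2 <= mdeg a)%N ->
  (exists i, 1 < a i)%N -> strand_boundary I a f.
Proof.
move=> Q1 Q2 [fS fZ] pa [i0 ai0].
have fU S : ~~ (S \subset mnm_supp a) -> f S = 0.
  by move=> Sa; apply/eqP; apply: contraNT Sa => /fS[].
(* At a non-loop of exponent at least 2, removing [i] from [S] creates no new condition, so [i] is a
   cone point. *)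
have [i /andP[ai li]|all_loops] := pickP (fun i => (1 < a i)%N && ~~ loop i).
  apply: (cone_acyclic (i := i)) => // [|S /in_quotP[Sa He Hl]].
    by rewrite inE; lia.
  apply/in_quotP; split=> [|j k ne_jk aj ak|j].
  - by apply: subset_trans Sa; apply: subsetDl.
  - apply: He => //.
      by move: aj; rewrite !inE; case: eqVneq => [->|] //= _; lia.
    by move: ak; rewrite !inE; case: eqVneq => [->|] //= _; lia.
  - by rewrite !inE; case: eqVneq => [->|] //= _; apply: Hl.
have big_loop j : (1 < a j)%N -> loop j.
  by move=> aj; have := all_loops j; rewrite aj /= => /negbFE.
have li0 := big_loop i0 ai0.
(* By [Q2], a neighbour [k] of the loop [i0] is adjacent to all other vertices left by [S]; with
   exponent 1 it is a cone point. *)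
have [k /and3P[ak eik ak1]|no_k] := pickP (fun k => [&& 0 < a k, e i0 k & a k <= 1])%N.
  have ki : k != i0 by apply: contraTneq eik => ->; rewrite e_irr.
  apply: (cone_acyclic (i := k)) => // [|S /in_quotP[Sa He Hl]].
    by rewrite inE.
  have i0S : (i0 \in S < a i0)%N by case: (i0 \in S); lia.
  have kl l : l != k -> (l \in S < a l)%N -> e k l.
    move=> lk al; have [->|li] := eqVneq l i0; first by rewrite e_sym.
    apply: (Q2 i0) => //; last by rewrite eq_sym.
    by apply: He; rewrite // eq_sym.
  apply/in_quotP; split=> [|j l ne_jl aj al|j].
  - by apply: subset_trans Sa; apply: subsetDl.
  - move: aj al; rewrite !inE.
    have [Ej|jk] := eqVneq j k => /= aj; have [El|lk] := eqVneq l k => /= al.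
    + by rewrite Ej El eqxx in ne_jl.
    + by rewrite Ej; apply: kl.
    + by rewrite El e_sym; apply: kl.
    + exact: He.
  - by rewrite !inE; have [->|jk] := eqVneq j k => /= aj; [lia | apply: Hl].
(* Otherwise, using [Q1], the monomial left by [S] is x_i0 alone, so [mdeg a] is [#|S| + 1], too
   small for [S] in the support of [f]. *)
apply: strand_boundary0 => S /in_quotP[Sa He Hl].
apply/eqP; apply: contraTT pa => /fS[_ <-].
have ai2 : a i0 = (i0 \in S).+1.
  have : ~~ ((i0 \in S).+1 < a i0)%N by apply: contraL li0 => /Hl.
  by move: ai0; case: (i0 \in S); lia.
have aE : a = (mnm_set S + U_(i0))%MM.
  apply/mnmP => k; rewrite mnmDE mnm_setE mnm1E.
  have [<-|ki] := eqVneq i0 k; first by rewrite ai2 addn1.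
  rewrite addn0; have : (k \in S <= a k)%N.
    by case: (boolP (k \in S)) => // /(subsetP Sa); rewrite inE.
  rewrite leq_eqVlt => /predU1P[//|ak].
  have eik : e i0 k by apply: He; rewrite // ai2.
  have ak0 : (0 < a k)%N by apply: leq_ltn_trans ak.
  have [ak1|ak1] := leqP (a k) 1; first by have := no_k k; rewrite ak0 eik ak1.
  by have := Q1 i0 k li0 (big_loop k ak1); rewrite eik.
by rewrite aE mdegD mdeg_mnm_set mdeg1; lia.
Qed.

(** The loops force every [S] in the quotient to contain [b] and [b'], so the strand is spanned by
    [S0] and carries no differential. *)
Lemma strand_two_loops b b' : loop b -> loop b' -> e b b' ->
  let a := (mnm_set [set b; b'] + mnm_set [set b; b'])%MM in
  exists f, strand_cycle I a 2 f /\ ~ strand_boundary I a f.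
Proof.
move=> lb lb' ebb' a; set S0 := [set b; b'] in a *.
have ne_bb' : b != b' by apply: contraTneq ebb' => ->; rewrite e_irr.
have aE i : a i = ((i \in S0) + (i \in S0))%N by rewrite mnmDE mnm_setE.
have supp_a : mnm_supp a = S0.
  by apply/setP => i; rewrite inE aE; case: (i \in S0).
have L0 : in_quot I a S0.
  apply/in_quotP; rewrite supp_a; split=> // [i k ne_ik|i]; rewrite !aE.
    case: (boolP (i \in S0)) => // iS _; case: (boolP (k \in S0)) => // kS _.
    by move/cliqueP: (clique2 e_sym ebb'); apply.
  by case: (i \in S0).
have LS S : in_quot I a S -> S = S0.
  move=> /in_quotP[]; rewrite supp_a => SS0 _ Hl.
  apply/eqP; rewrite eqEsubset SS0; apply/subsetP => i iS0.
  apply: contraT => iS; have := Hl i; rewrite aE iS0 (negbTE iS) => /(_ isT).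
  by move: iS0; rewrite !inE => /pred2P[] ->; rewrite ?lb ?lb'.
have bdry0 g : (forall S, ~~ (S \subset S0) -> g S = 0) -> bdry g S0 = 0.
  move=> gU; rewrite /bdry big1 // => i iS; rewrite gU ?mulr0 //.
  by rewrite subUset sub1set (negbTE iS).
exists (fun S => (S == S0)%:R); split.
  split=> S; last first.
    by move/LS->; apply: bdry0 => S'; case: eqVneq => [->|] //; rewrite subxx.
  case: (eqVneq S S0) => [-> _|_]; last by rewrite eqxx.
  by rewrite supp_a cards2 ne_bb'.
move=> [g [gU gE]]; rewrite supp_a in gU; have := gE _ L0.
by rewrite eqxx bdry0 // => /eqP; rewrite oner_eq0.
Qed.

(** The loop forces [b] into [S], and [S] cannot be [[set b]] because [u] and [v] are nonadjacent.
    Two elements of Koszul degree 2 remain, and the boundary of [U] involves both, so neither bounds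
    alone. *)
Lemma strand_loop_fork b u v : loop b -> e b u -> e b v -> u != v -> ~~ e u v ->
  let a := (mnm_set [set b; u; v] + U_(b))%MM in
  [/\ mdeg a = 4 & exists f, strand_cycle I a 2 f /\ ~ strand_boundary I a f].
Proof.
move=> lb ebu ebv ne_uv euv a; set U := [set b; u; v] in a *.
have ne_bu : b != u by apply: contraTneq ebu => ->; rewrite e_irr.
have ne_bv : b != v by apply: contraTneq ebv => ->; rewrite e_irr.
have aE i : a i = ((i \in U) + (b == i))%N by rewrite mnmDE mnm_setE mnm1E.
have [bU uU vU] : [/\ b \in U, u \in U & v \in U] by rewrite !inE !eqxx !orbT.
have ab : a b = 2 by rewrite aE bU eqxx.
have au : a u = 1%N by rewrite aE uU (negbTE ne_bu).
have av : a v = 1%N by rewrite aE vU (negbTE ne_bv).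
have a0 i : i \notin U -> a i = 0%N.
  move=> iU; rewrite aE (negbTE iU); case: eqVneq => // E.
  by rewrite -E bU in iU.
have supp_a : mnm_supp a = U.
  apply/setP => i; rewrite inE; case: (boolP (i \in U)) => [|/a0-> //].
  by rewrite aE => ->.
have cU : #|U| = 3.
  rewrite /U setUC cardsU1 !inE ![v == _]eq_sym (negbTE ne_bv) (negbTE ne_uv).
  by rewrite cards2 ne_bu.
have Uw w w' : [set b; w] \subset U -> U = w' |: [set b; w] -> w' \notin [set b; w] ->
    e b w' -> in_quot I a [set b; w].
  move=> wU UE w'w ebw'; apply/in_quotP; rewrite supp_a; split=> // [i k ne_ik|i].
    have Hi j : (j \in [set b; w] < a j)%N -> j = b \/ j = w'.
      have [jw|jw] := boolP (j \in [set b; w]).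
        by rewrite aE; case: eqP => [-> _|_]; [left | case: (j \in U)].
      have [|/a0-> //] := boolP (j \in U); rewrite UE in_setU1 (negbTE jw) orbF.
      by move/eqP=> ->; right.
    move=> /Hi iE /Hi kE; case: iE ne_ik => ->; case: kE => -> ne_ik //.
    - by rewrite eqxx in ne_ik.
    - by rewrite e_sym.
    - by rewrite eqxx in ne_ik.
  have [iw|iw] := boolP (i \in [set b; w]).
    by rewrite aE; case: (i \in U); case: (b == i).
  rewrite aE; case: eqP => [E|_]; last by case: (i \in U).
  by rewrite -E set21 in iw.
have Lu : in_quot I a [set b; u].
  apply: (Uw u v) => //.
  - by rewrite subUset !sub1set bU.
  - by rewrite /U setUC.
  - by rewrite !inE ![v == _]eq_sym (negbTE ne_bv) (negbTE ne_uv).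
have Lv : in_quot I a [set b; v].
  apply: (Uw v u) => //.
  - by rewrite subUset !sub1set bU.
  - by apply/setP => i; rewrite !inE orbCA orbA.
  - by rewrite !inE ![u == _]eq_sym (negbTE ne_bu) eq_sym (negbTE ne_uv).
split; first by rewrite mdegD mdeg_mnm_set cU mdeg1.
exists (fun S => (S == [set b; u])%:R); split.
  split=> S.
    case: (eqVneq S [set b; u]) => [-> _|_]; last by rewrite eqxx.
    by rewrite supp_a subUset !sub1set bU cards2 ne_bu.
  move=> /in_quotP[_ He Hl]; rewrite /bdry big1 // => i iS.
  case: eqP => [E|_]; rewrite ?mulr0 //.
  have bS : b \in S.
    by apply: contraT => bS; have := Hl b; rewrite (negbTE bS) ab lb => /(_ isT).
  have Su j : j \in S -> j = b \/ j = u.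
    by move=> /(setU1r i); rewrite E !inE => /pred2P.
  have uS : u \notin S.
    apply: contra iS => uS; have : i \in i |: S by rewrite setU11.
    by rewrite E !inE => /pred2P[] ->.
  have vS : v \notin S.
    apply/negP => /Su[] E'; first by rewrite E' eqxx in ne_bv.
    by rewrite E' eqxx in ne_uv.
  by case/negP: euv; apply: He; rewrite // ?(negbTE uS) ?(negbTE vS) ?au ?av.
move=> [g [gU gE]]; rewrite supp_a in gU.
have bd w w' : [set b; w] \subset U -> U = w' |: [set b; w] -> w' \notin [set b; w] ->
    bdry g [set b; w] = sgn K w' [set b; w] * g U.
  move=> wU UE w'w; rewrite /bdry (bigD1 w') //= -UE big1 ?addr0 // => i /andP[iw iw'].
  rewrite gU ?mulr0 // subUset wU andbT sub1set UE in_setU1 negb_or iw' //.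
(* The coefficient at [[set b; v]] kills [g U], contradicting the coefficient 1 at [[set b; u]]. *)
have gU0 : g U = 0.
  have := gE _ Lv; rewrite (bd v u); first last.
  - by rewrite !inE ![u == _]eq_sym (negbTE ne_bu) eq_sym (negbTE ne_uv).
  - by apply/setP => i; rewrite !inE orbCA orbA.
  - by rewrite subUset !sub1set bU.
  case: eqP => [E|_]; last first.
    move/(congr1 (fun z => sgn K u [set b; v] * z)); by rewrite mulrA sgn2 mul1r mulr0.
  have := set22 b v; rewrite E !inE eq_sym (negbTE ne_bv) eq_sym (negbTE ne_uv) //.
have := gE _ Lu; rewrite (bd u v); first last.
- by rewrite !inE ![v == _]eq_sym (negbTE ne_bv) (negbTE ne_uv).
- by rewrite /U setUC.
- by rewrite subUset !sub1set bU.
by rewrite gU0 mulr0 eqxx => /eqP; rewrite oner_eq0.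
Qed.

(** * Squarefree strands and cochains of the clique complex *)

Section SquarefreeStrand.
Variable W : {set 'I_n}.
Local Notation a := (mnm_set W).

(* Complementation in W turns Koszul chains into cochains of the clique complex. *)
Definition csgn i X : K := sgn K i (W :\: X).

Lemma csgn2 i X : csgn i X * csgn i X = 1.
Proof. exact: sgn2. Qed.

Let setDD1 X i : i \in X -> X \subset W -> W :\: (X :\ i) = i |: (W :\: X).
Proof.
move=> iX XW; apply/setP => j; rewrite !inE; case: eqVneq => [->|] //=.
by rewrite (subsetP XW).
Qed.

Lemma csgnA X i k : X \subset W -> i \in X -> k \in X -> i != k ->
  csgn i X * csgn k (X :\ i) = - (csgn k X * csgn i (X :\ k)).
Proof.
move=> XW iX kX ne_ik; rewrite /csgn !setDD1 //; apply: sgnA => //.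
  by rewrite inE iX.
by rewrite inE kX.
Qed.

Lemma bdry_cobd f X : (forall S, ~~ (S \subset W) -> f S = 0) -> X \subset W ->
  bdry f (W :\: X) = cobd csgn (fun Y => f (W :\: Y)) X.
Proof.
move=> fW XW; rewrite /bdry (bigID (mem W)) /= [X in _ + X]big1 ?addr0; last first.
  by move=> i /andP[_ iW]; rewrite fW ?mulr0 // subUset sub1set (negbTE iW).
apply: eq_big => [i|i /andP[iS iW]].
  rewrite !inE negb_and negbK; case: (boolP (i \in X)) => [/(subsetP XW)->|] //=.
  by case: (i \in W).
have iX : i \in X by move: iS; rewrite inE iW andbT negbK.
by rewrite setDD1.
Qed.

Let DDW S : S \subset W -> W :\: (W :\: S) = S.
Proof. by move=> SW; rewrite setDDr setDv set0U; apply/setIidPr. Qed.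

Lemma strand_boundary_cobd p f g :
  (forall S, f S != 0 -> S \subset W /\ #|S| = p) ->
  (forall X, X \subset W -> clique e X -> (#|X| + p)%N = #|W| ->
     f (W :\: X) = cobd csgn g X) ->
  strand_boundary I a f.
Proof.
move=> fS fg.
(* Keeping only sets of size [p.+1] makes the equation trivial at every [S] of size other than
   [p]. *)
pose h S := if (S \subset W) && (#|S| == p.+1) then g (W :\: S) else 0.
have hW S : ~~ (S \subset W) -> h S = 0 by rewrite /h => /negbTE->.
exists h; split=> [S|S]; first by rewrite mnm_supp_set; apply: hW.
rewrite in_quot_set => /andP[SW clS].
have [cS|cS] := eqVneq #|S| p; last first.
  have /eqP -> : f S == 0 by apply: contraNT cS => /fS[_ ->].
  rewrite /bdry big1 // => i iS; rewrite /h cardsU1 iS eqSS (negbTE cS).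
  by rewrite andbF mulr0.
have XW : W :\: S \subset W := subsetDl _ _.
have cX : (#|W :\: S| + p)%N = #|W|.
  by have := cardsID S W; rewrite (setIidPr SW); lia.
have := fg _ XW clS cX; rewrite DDW // => ->.
rewrite -{2}(DDW SW) bdry_cobd //; apply: eq_bigr => i iX; congr (_ * _).
have iS : i \notin S by move: iX; rewrite inE => /andP[].
have cY : #|W :\: ((W :\: S) :\ i)| == p.+1 by rewrite setDD1 // DDW // cardsU1 iS cS.
by rewrite /h subsetDl cY DDW // (subset_trans (subsetDl _ _)).
Qed.

Lemma strand_acyclic_chordal p f : chordal e W -> (p + 2 <= #|W|)%N ->
  strand_cycle I a p f -> strand_boundary I a f.
Proof.
move=> chW pW [fS fZ]; rewrite mnm_supp_set in fS.
have fW S : ~~ (S \subset W) -> f S = 0.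
  by move=> SW; apply/eqP; apply: contraNT SW => /fS[].
(* Koszul degree [p] corresponds to simplices with [#|W| - p] vertices, and [p + 2 <= #|W|] says
   that their dimension is positive. *)
have [| |g gE] := chordal_acyclic e_sym e_irr csgn2 csgnA (subxx W) chW
  (t := (#|W| - p)%N) (f := fun X => f (W :\: X)).
- by lia.
- move=> X XW clX _; rewrite -bdry_cobd //; apply: fZ.
  by rewrite in_quot_set subsetDl DDW.
apply: (@strand_boundary_cobd p f g) => // X XW clX cX; apply: gE => //.
by rewrite -cX addnK.
Qed.

Section CycleStrand.
Variables (r : nat) (s : nat -> 'I_n).
Hypotheses (r4 : (4 <= r)%N) (cs : icycle e r s).
Hypothesis WE : forall x, x \in W <-> exists2 i, (i < r)%N & x = s i.

Let cW : #|W| = r := icycle_card cs WE.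

Definition cycle_class S : K :=
  if S \subset W then closing_edge K r s (W :\: S) else 0.

Let closing_edgeE S : S \subset W -> closing_edge K r s (W :\: S) != 0 ->
  #|S| = (r - 2)%N.
Proof.
move=> SW; rewrite /closing_edge.
case: (_ =P [set s 0; s r.-1]) => [E _|_]; last by rewrite eqxx.
have ne : s 0 != s r.-1.
  by apply/eqP => E'; case: cs => s_inj _; have := s_inj 0%N r.-1 _ _ E'; lia.
have := cardsID S W; rewrite (setIidPr SW) E cards2 ne cW; lia.
Qed.

Let classS S : cycle_class S != 0 -> S \subset W /\ #|S| = (r - 2)%N.
Proof.
rewrite /cycle_class; case: ifP => SW; last by rewrite eqxx.
by move/(closing_edgeE SW).
Qed.

(** A nonzero term of the boundary at [S] forces the complement of [S] to have 3 elements, which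
    would be a triangle in the cycle. *)
Lemma cycle_class_cycle : strand_cycle I a (r - 2) cycle_class.
Proof.
split=> [S|S]; first by rewrite mnm_supp_set; apply: classS.
rewrite in_quot_set => /andP[SW clS].
have cWS : (#|S| + #|W :\: S|)%N = r.
  by have := cardsID S W; rewrite (setIidPr SW) cW.
have [c3|c3] := eqVneq #|W :\: S| 3.
  by case: (icycle_no_triangle r4 cs WE (subsetDl W S) clS c3).
rewrite /bdry big1 // => i iS; apply/eqP; apply: contraNT c3.
rewrite mulf_eq0 negb_or => /andP[_ /classS[_]]; rewrite cardsU1 iS; lia.
Qed.

Lemma cycle_class_span f : strand_cycle I a (r - 2) f ->
  exists x, strand_boundary I a (fun S => f S - x * cycle_class S).
Proof.
move=> [fS fZ]; rewrite mnm_supp_set in fS.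
have [x [g gE]] := icycle_span csgn2 csgnA r4 cs WE (subxx W) (fun X => f (W :\: X)).
exists x; apply: (@strand_boundary_cobd (r - 2) _ g).
  move=> S; have [/fS//|/negbNE/eqP ->] := boolP (f S != 0).
  by rewrite sub0r oppr_eq0 mulf_eq0 negb_or => /andP[_ /classS].
move=> X XW clX cX; rewrite /cycle_class subsetDl DDW //; apply: gE => //; 
  by apply/eqP; rewrite -(eqn_add2r (r - 2)) cX cW; apply/eqP; lia.
Qed.

Lemma cycle_class_indep x :
  strand_boundary I a (fun S => x * cycle_class S) -> x = 0.
Proof.
move=> [g [gW gE]]; rewrite mnm_supp_set in gW.
apply: (icycle_indep e_sym csgn2 csgnA r4 cs WE (subxx W)
  (g := fun X => g (W :\: X))) => X XW clX cX.
rewrite -bdry_cobd // -gE ?in_quot_set ?subsetDl ?DDW //.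
by rewrite /cycle_class subsetDl DDW.
Qed.

End CycleStrand.
End SquarefreeStrand.
End StrandHomology.

(* The first nonlinear degree *)
Local Close Scope ring_scope.

Theorem theorem4p6 (K : fieldType) (n : nat) (I : {pred {mpoly K[n]}})
    (F : free_sequence K n) (r : nat)
    (I_quadratic : generated_by_quadratic_monomials I)
    (F_res : minimal_graded_free_resolution I F)
    (F_not_linear : ~ linear_resolution F)
    (r_smallest : is_smallest
       (fun s => 4 <= s /\ exists i, i + 3 <= s /\ betti F i s <> 0) r)
    (I_squarefree : r = 4 -> squarefree_monomial_ideal I) :
  is_smallest
    (fun s => 4 <= s /\
       exists C, C \in induced_cycles (compl_graph (ideal_graph I)) s) r
  /\ betti F (r - 3) r = #|induced_cycles (compl_graph (ideal_graph I)) r|.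
Proof.
set e := compl_graph (ideal_graph I).
have e_sym : ssrbool.symmetric e := compl_ideal_graph_sym I.
have e_irr : irreflexive e := compl_ideal_graph_irr I.
have [[r4 [i0 [i0r bi0]]] r_min] := r_smallest.
have card_cover s C : C \in induced_cycles e s -> #|cover C| = s.
  by case/(induced_icycle e_sym e_irr) => c cs /(icycle_card cs).
have r_le s C : 4 <= s -> C \in induced_cycles e s -> r <= s.
  move=> s4 iC; apply: r_min; split=> //; exists (s - 3); split; first lia.
  have [c cs cE] := induced_icycle e_sym e_irr iC.
  rewrite -{2}(card_cover _ _ iC) -mdeg_mnm_set.
  apply: (betti_strand_neq0 I_quadratic F_res (f := cycle_class K (cover C) s c)).
    have -> : (s - 3).+1 = s - 2 by lia.
    exact: cycle_class_cycle.
  move=> H; apply/(elimN eqP (oner_neq0 K)).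
  apply: (cycle_class_indep I_quadratic s4 cs cE).
  by apply: strand_boundary_ext H => S; rewrite mul1r.
(* A loop is incompatible with squarefreeness, hence with r = 4; this makes [betti14] available
   wherever loops have to be controlled. *)
have loop_r4 b : ideal_graph I b b -> 4 < r.
  move=> lb; rewrite ltn_neqAle r4 andbT; apply/eqP => /esym/I_squarefree sf.
  by have := squarefree_no_loop I_quadratic sf b; rewrite lb.
have betti14 : 4 < r -> betti F 1 4 = 0.
  move=> r5; apply/eqP/negPn/negP => /eqP b14.
  suff : r <= 4 by lia.
  by apply: r_min; split=> //; exists 1.
have no_two_loops b b' : ideal_graph I b b -> ideal_graph I b' b' -> ~~ e b b'.
  move=> lb lb'; apply/negP => ebb'.
  have [f [fZ fB]] := strand_two_loops I_quadratic lb lb' ebb'.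
  have := betti_strand_neq0 I_quadratic F_res fZ fB; apply.
  rewrite mdegD mdeg_mnm_set cards2.
  have -> : b != b' by apply: contraTneq ebb' => ->; rewrite e_irr.
  exact: betti14 (loop_r4 b lb).
have loop_nbhd b u v : ideal_graph I b b -> e b u -> e b v -> u != v -> e u v.
  move=> lb ebu ebv uv; apply/negPn/negP => euv.
  have [a4 [f [fZ fB]]] := strand_loop_fork I_quadratic lb ebu ebv uv euv.
  have := betti_strand_neq0 I_quadratic F_res fZ fB; apply.
  by rewrite a4; apply: betti14 (loop_r4 b lb).
have acyclic i (a : 'X_{1..n}) f : i + 3 <= r -> mdeg a = r ->
    (forall C, C \in induced_cycles e r -> a != mnm_set (cover C)) ->
    strand_cycle I a i.+1 f -> strand_boundary I a f.
  move=> ir ar aC fZ; have [/existsP[k ak]|sqf] := boolP [exists k, 1 < a k].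
    apply: (strand_acyclic_not_squarefree I_quadratic _ _ fZ) => //; last by exists k.
    by rewrite ar; lia.
  have aE : a = mnm_set (mnm_supp a).
    apply/mnmP => k; rewrite mnm_setE inE.
    have : ~~ (1 < a k) by apply: contra sqf => ak; apply/existsP; exists k.
    by lia.
  have cW : #|mnm_supp a| = r by rewrite -mdeg_mnm_set -aE.
  rewrite aE in fZ *; apply: (strand_acyclic_chordal I_quadratic _ _ fZ).
    move=> m s m4 cs sW.
    pose W := [set s (k : 'I_m) | k in 'I_m].
    have WE x : x \in W <-> exists2 k, k < m & x = s k.
      split=> [/imsetP[k _ ->]|[k km ->]]; first by exists k.
      by apply/imsetP; exists (Ordinal km).
    have [C iC CW] := icycle_induced (ltnW m4) cs WE.
    (* By [r_le] the cycle has at least [r] vertices, and the support of [a] has only [r]. *)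
    have EW : W = mnm_supp a.
      apply/eqP; rewrite eqEcard (icycle_card cs WE) cW (r_le m C) // andbT.
      by apply/subsetP => x /WE[k /sW + ->].
    have mr : m = r by rewrite -cW -EW (icycle_card cs WE).
    rewrite mr in iC.
    by have /eqP[] := aC C iC; rewrite CW EW.
  by rewrite cW; lia.
have [C0 C0J] : exists C, C \in induced_cycles e r.
  (* Without induced [r]-cycles every strand relevant to [i0] would be acyclic, against [bi0]. *)
  have [J0|[C CJ]] := set_0Vmem (induced_cycles e r); last by exists C.
  case: bi0; apply: (betti_strand_eq0 I_quadratic F_res) => a f ar.
  by apply: (acyclic i0) => // C; rewrite J0 inE.
split; first by split=> [|s [s4 [C iC]]]; [split=> //; exists C0 | apply: r_le s4 iC].
have r3 : (r - 3).+1 = r - 2 by lia.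
have classes C : exists f, C \in induced_cycles e r ->
    [/\ strand_cycle I (mnm_set (cover C)) (r - 2) f,
        forall x, strand_boundary I (mnm_set (cover C)) (fun S => x * f S)%R -> x = 0%R
      & forall f', strand_cycle I (mnm_set (cover C)) (r - 2) f' ->
          exists x, strand_boundary I (mnm_set (cover C)) (fun S => f' S - x * f S)%R].
  have [iC|] := boolP (C \in induced_cycles e r); last by exists (fun=> 0%R).
  have [c cs cE] := induced_icycle e_sym e_irr iC.
  exists (cycle_class K (cover C) r c) => _; split.
  - exact: cycle_class_cycle.
  - by move=> x; apply: cycle_class_indep.
  - by move=> f'; apply: cycle_class_span.
have [ff ffE] := fin_all_exists classes.
apply: (betti_strand I_quadratic F_res (aa := fun C => mnm_set (cover C)) (ff := ff)).
- by move=> C C' iC iC' /mnm_set_inj; apply: induced_cycle_cover_inj iC iC'.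
- by move=> C iC; rewrite mdeg_mnm_set; apply: card_cover.
- by move=> C /ffE[]; rewrite r3.
- by move=> C x /ffE[_ + _]; apply.
- by move=> C f /ffE[_ _]; rewrite r3; apply.
- by move=> a f ar aC; apply: acyclic => //; lia.
Qed.
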